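(* For every integer $n\ge 1$, the sixth moment about the mean $m_6(n)=E[(X_n-c_n)^6]$ of the number $X_n$ of comparisons performed by Quicksort on a random list of length $n$ is $$\begin{aligned} m_6(n)={}&\tfrac1{2700}n(74250517n^5+523547007n^4+1579578725n^3+2571768745n^2+2342670258n+1133389148)\\ &-\tfrac23(n+1)(11300n^4+56270n^3+135760n^2+145510n+68427)H_1(n)\\ &+20(63n^2+117n+329)(n+1)^2H_1(n)^2-120(n+1)^3H_1(n)^3\\ &+\Big(-\tfrac43(11300n^4+51710n^3+101830n^2+93640n+26013)(n+1)^2\\ &\qquad+240(21n^2+39n+68)(n+1)^3H_1(n)-720(n+1)^4H_1(n)^2\Big)H_2(n)\\ &+\Big(240(21n^2+39n+37)(n+1)^4-1440(n+1)^5H_1(n)\Big)H_2(n)^2-960(n+1)^6H_2(n)^3\\ &+\Big(-160(38n^3+225n^2+325n+159)(n+1)^3+7360(n+1)^4H_1(n)+9600(n+1)^5H_2(n)\Big)H_3(n)\\ &+2560(n+1)^6H_3(n)^2\\ &+\Big(-480(21n^2+39n+37)(n+1)^4+2880(n+1)^5H_1(n)+5760(n+1)^6H_2(n)\Big)H_4(n)\\ &-11520(n+1)^5H_5(n)-7680(n+1)^6H_6(n).\end{aligned}$$ Moreover, the scaled sixth moment satisfies $$\lim_{n\to\infty}\frac{m_6(n)}{m_2(n)^3}=\frac{\frac{74250517}{2700}-\frac{22600}{9}\pi^2+140\pi^4-\frac{88}{7}\pi^6-6080\zeta(3)+2560\zeta(3)^2+\frac1{90}(960\pi^2-10080)\p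i^4}{(7-\frac23\pi^2)^3}=44.427077\ldots$$
   Context: Quicksort on a list $L$ of $n$ distinct entries: if $n\le 1$, return $L$ (no comparisons). Otherwise choose a pivot uniformly at random among the $n$ entries, compare it with each of the other $n-1$ entries (using $n-1$ comparisons) to split them into the list of smaller entries and the list of larger entries, and recursively sort the two lists. $X_n$ denotes the (random) total number of comparisons for a random list of length $n$. Equivalently, $X_n$ is the random variable with values in the nonnegative integers whose probability generating function $g_n(t)=\sum_k \Pr(X_n=k)t^k$ is determined by $g_0(t)=1$ and, for $n\ge1$, $g_n(t)=\frac{t^{n-1}}{n}\sum_{k=1}^n g_{k-1}(t)g_{n-k}(t)$. $c_n=E[X_n]$ and, for $r\ge 2$, $m_r(n)=E[(X_n-c_n)^r]$ is the $r$-th moment about the mean. $H_m(n)=\sum_{i=1}^n \frac1{i^m}$. $\zeta$ is the Riemann zeta function. *)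

(* Defs.v *)
From Stdlib Require Import Reals List Arith.
From Coquelicot Require Import Coquelicot.
Import ListNotations.
Open Scope R_scope.

(** A finitely supported distribution, as a list of (probability, outcome)
    pairs; an outcome may occur several times, its probabilities then add up. *)
Definition fdist (A : Type) : Type := list (R * A).

Definition ret {A : Type} (a : A) : fdist A := [(1, a)].

Definition bind {A B : Type} (d : fdist A) (f : A -> fdist B) : fdist B :=
  flat_map (fun pa => map (fun qb => (fst pa * fst qb, snd qb)) (f (snd pa))) d.

Definition uniform {A : Type} (l : list A) : fdist A :=
  map (fun a => (/ INR (length l), a)) l.

Definition expectation {A : Type} (d : fdist A) (f : A -> R) : R :=
  fold_right Rplus 0 (map (fun pa => fst pa * f (snd pa)) d).

(** Randomized Quicksort. An outcome is the output list together with the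
    number of comparisons made; splitting makes one comparison [y <? p] for
    each entry [y] other than the pivot [p]. The first argument only bounds the
    recursion depth; the length of the list suffices, since both parts of a
    split are strictly shorter than the list. *)
Fixpoint quicksort_rec (depth : nat) (L : list nat) : fdist (list nat * nat) :=
  match depth with
  | O => ret (L, O)
  | S depth' =>
      if (length L <=? 1)%nat then ret (L, O)
      else
        bind (uniform L) (fun p =>
          let others := remove Nat.eq_dec p L in
          let (smaller, larger) := partition (fun y => (y <? p)%nat) others in
          bind (quicksort_rec depth' smaller) (fun s =>
            bind (quicksort_rec depth' larger) (fun l =>
              ret (fst s ++ p :: fst l,
                   (length others + snd s + snd l)%nat))))
  end.

Definition quicksort (L : list nat) : fdist (list nat * nat) :=
  quicksort_rec (length L) L.

Fixpoint insertions {A : Type} (x : A) (l : list A) : list (list A) :=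
  match l with
  | [] => [[x]]
  | y :: l' => (x :: l) :: map (cons y) (insertions x l')
  end.

Fixpoint permutations {A : Type} (l : list A) : list (list A) :=
  match l with
  | [] => [[]]
  | x :: l' => flat_map (insertions x) (permutations l')
  end.

(** The distribution of the number of comparisons on a random list of
    length [n], i.e. on a uniformly random ordering of [1, ..., n]. *)
Definition X (n : nat) : fdist nat :=
  bind (uniform (permutations (seq 1 n))) (fun L =>
    bind (quicksort L) (fun r => ret (snd r))).

Definition c (n : nat) : R := expectation (X n) INR.

Definition m (r n : nat) : R :=
  expectation (X n) (fun k => (INR k - c n) ^ r).

Definition H (s n : nat) : R := sum_n_m (fun i => / INR i ^ s) 1 n.

(** The Dirichlet series of the Riemann zeta function, for real [s > 1]. *)
Definition zeta (s : R) : R := Series (fun k => / Rpower (INR (S k)) s).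

(* Main.v *)
Require Import Defs.
From Stdlib Require Import Reals List Arith ZArith Lia Lra Permutation.
From Stdlib Require Import FunctionalExtensionality.
From Coquelicot Require Import Coquelicot.
Import ListNotations.
Open Scope R_scope.

(** The number of comparisons satisfies a distributional recurrence in the
    length of the list alone ([cost_mean_succ]). Shift it to
    [Y_n = X_n + 2 n], so that the recurrence reads
    [Y_n = (n + 1) + Y_k + Y'_(n-1-k)] with [k] uniform on [0, ..., n - 1], and
    let [P_r(z)] be the sum over [n] of [E[Y_n^r] z^n]. Expanding the [r]-th
    power and writing [theta = z d/dz], the recurrence becomes the system of
    differential equations

      [P_r' = sum over i + j + k = r of r!/(i! j! k!) (theta + 2)^i (P_j P_k)],

    whose coefficients of [z^n] determine those of [z^(n+1)]. With
    [u = 1/(1-z)] and [L = log u] one has [u' = u^2], [L' = u],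
    [theta u = u^2 - u] and [theta L = u - 1]. Solving the equations one after
    the other yields polynomials in [u] and [L] for [r <= 6]; once the
    polynomials are written down, verifying the equations is a finite
    computation with integer coefficients.

    The coefficient of [z^n] in [u L^k] is [k!] times the [k]-th elementary
    symmetric polynomial of [1, 1/2, ..., 1/n], hence a polynomial in
    [H_1(n), ..., H_k(n)] by Newton's identities ([esym_harmonic]), and
    [theta] multiplies the coefficient of [z^n] by [n]. Writing each [P_r] as a
    combination of the [theta^i (u L^k)] therefore gives
    [E[Y_n^r]] as a polynomial in [n] and the harmonic numbers
    ([moment_tabulated]), and the moments about the mean of [X_n], which are
    those of [Y_n], follow by the binomial theorem.

    The formulas for [m 2 n] and [m 6 n] are homogeneous of degrees 2 and 6 when
    [n], [1] and [H_1(n)] get degree 1 and the other harmonic numbers degree 0.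
    Since [1/n] and [H_1(n)/n] tend to 0, the quotient tends to an expression in
    [zeta(2), zeta(3), zeta(4), zeta(6)]; the even values come from the power
    sums of [1/sin^2] at the odd multiples of [PI / 2^(n+2)], which obey a
    doubling recurrence. The decimals of the limit follow from a Machin-like series
    for [PI] and from Euler-Maclaurin bounds for the tail of [zeta(3)]. *)

(** * Expectations over finitely supported distributions *)

Definition total (l : list R) : R := fold_right Rplus 0 l.

Lemma total_app (l l' : list R) : total (l ++ l') = total l + total l'.
Proof.
  unfold total; induction l as [|x l IH]; cbn; [ring|rewrite IH; ring].
Qed.

Lemma total_permutation (l l' : list R) : Permutation l l' -> total l = total l'.
Proof.
  unfold total; induction 1; cbn; lra.
Qed.

Lemma expectation_bind {A B : Type} (d : fdist A) (f : A -> fdist B) (g : B -> R) :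
  expectation (bind d f) g = expectation d (fun a => expectation (f a) g).
Proof.
  unfold expectation, bind; induction d as [|[p a] d IH]; [reflexivity|].
  cbn [flat_map map fold_right fst snd].
  rewrite map_app, map_map; cbn [fst snd].
  change (total (map (fun qb => p * fst qb * g (snd qb)) (f a)
                 ++ map (fun pa => fst pa * g (snd pa))
                      (flat_map (fun pa => map (fun qb => (fst pa * fst qb, snd qb))
                                             (f (snd pa))) d)) =
          p * total (map (fun qb => fst qb * g (snd qb)) (f a))
          + fold_right Rplus 0 (map (fun pa =>
              fst pa * fold_right Rplus 0 (map (fun qb => fst qb * g (snd qb))
                                             (f (snd pa)))) d)).
  rewrite total_app; f_equal; [|exact IH].
  unfold total; induction (f a) as [|[q b] e IHe]; cbn; [ring|].
  rewrite IHe; ring.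
Qed.

Lemma expectation_ret {A : Type} (a : A) (g : A -> R) : expectation (ret a) g = g a.
Proof. cbn; ring. Qed.

Lemma expectation_ext {A : Type} (d : fdist A) (f g : A -> R) :
  (forall a, f a = g a) -> expectation d f = expectation d g.
Proof. intros E; now replace g with f by now extensionality a. Qed.

Lemma expectation_plus {A : Type} (d : fdist A) (f g : A -> R) :
  expectation d (fun a => f a + g a) = expectation d f + expectation d g.
Proof.
  unfold expectation; induction d as [|[p a] d IH]; cbn in *; [|rewrite IH]; ring.
Qed.

Lemma expectation_scal {A : Type} (d : fdist A) (x : R) (f : A -> R) :
  expectation d (fun a => x * f a) = x * expectation d f.
Proof.
  unfold expectation; induction d as [|[p a] d IH]; cbn in *; [|rewrite IH]; ring.
Qed.

Lemma expectation_uniform {A : Type} (l : list A) (g : A -> R) :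
  expectation (uniform l) g = / INR (length l) * total (map g l).
Proof.
  unfold expectation, uniform, total; generalize (/ INR (length l)) as w; intros w.
  rewrite map_map; cbn [fst snd].
  induction l as [|a l IH]; cbn in *; [|rewrite IH]; ring.
Qed.

(** * The recurrence for the number of comparisons *)

(** The law of the number of comparisons, stripped of the lists: a pivot of
    rank [k] among [n] entries leaves parts of lengths [k] and [n - 1 - k]. *)
Fixpoint comparisons (depth n : nat) : fdist nat :=
  match depth with
  | O => ret O
  | S depth' =>
      if (n <=? 1)%nat then ret O
      else
        bind (uniform (seq 0 n)) (fun k =>
          bind (comparisons depth' k) (fun a =>
            bind (comparisons depth' (n - 1 - k)) (fun b =>
              ret (n - 1 + a + b)%nat)))
  end.

Lemma comparisons_succ (depth n : nat) :
  (1 < n)%nat ->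
  comparisons (S depth) n =
    bind (uniform (seq 0 n)) (fun k =>
      bind (comparisons depth k) (fun a =>
        bind (comparisons depth (n - 1 - k)) (fun b =>
          ret (n - 1 + a + b)%nat))).
Proof. intros h; cbn [comparisons]; destruct (Nat.leb_spec n 1); [lia|easy]. Qed.

Definition rank (L : list nat) (p : nat) : nat :=
  length (filter (fun y => (y <? p)%nat) L).

Lemma rank_lt (L : list nat) (p q : nat) :
  In p L -> (p < q)%nat -> (rank L p < rank L q)%nat.
Proof.
  unfold rank; intros Hp Hpq.
  assert (Hle : forall l, (length (filter (fun y => (y <? p)%nat) l)
                           <= length (filter (fun y => (y <? q)%nat) l))%nat).
  { induction l as [|y l IH]; [easy|]; cbn [filter].
    destruct (Nat.ltb_spec y p), (Nat.ltb_spec y q); cbn [length]; lia. }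
  induction L as [|y L IH]; [easy|]; cbn [filter].
  specialize (Hle L).
  destruct Hp as [->|Hp]; [|specialize (IH Hp)];
    repeat match goal with |- context [(?a <? ?b)%nat] => destruct (Nat.ltb_spec a b) end;
    cbn [length]; lia.
Qed.

(** A pivot chosen uniformly in [L] has a uniform rank: [rank L] is injective on
    [L] with values below [length L]. *)
Lemma rank_permutation (L : list nat) :
  NoDup L -> Permutation (map (rank L) L) (seq 0 (length L)).
Proof.
  intros HL; apply NoDup_Permutation_bis.
  - assert (Hinj : forall p q, In p L -> In q L -> rank L p = rank L q -> p = q).
    { intros p q Hp Hq E; destruct (Nat.lt_trichotomy p q) as [h|[h|h]]; trivial;
        [apply (rank_lt L) in h|apply (rank_lt L) in h]; trivial; lia. }
    revert HL Hinj; generalize (rank L) as f; intros f.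
    induction L as [|x L IH]; intros HL Hinj; cbn; [constructor|].
    inversion HL as [|? ? Hx HL']; subst; constructor.
    + intros Hin; apply in_map_iff in Hin as (y & E & Hy).
      apply Hinj in E; [subst; contradiction|now right|now left].
    + apply IH; [trivial|intros p q Hp Hq; apply Hinj; now right].
  - now rewrite length_map, length_seq.
  - intros r Hr; apply in_map_iff in Hr as (p & <- & Hp); apply in_seq.
    split; [lia|].
    unfold rank; induction L as [|y L IH]; [easy|]; cbn [filter length Nat.add] in *.
    inversion HL as [|? ? Hy HL']; subst.
    destruct Hp as [->|Hp].
    + rewrite Nat.ltb_irrefl.
      pose proof (filter_length_le (fun y => (y <? p)%nat) L); lia.
    + specialize (IH HL' Hp); destruct (y <? p)%nat; cbn [length]; lia.
Qed.

Lemma length_remove (L : list nat) (p : nat) :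
  NoDup L -> In p L -> length (remove Nat.eq_dec p L) = (length L - 1)%nat.
Proof.
  intros HL Hp; induction L as [|y L IH]; [easy|]; cbn.
  inversion HL as [|? ? Hy HL']; subst.
  destruct (Nat.eq_dec p y) as [->|Hne].
  - rewrite notin_remove by trivial; lia.
  - destruct Hp as [->|Hp]; [easy|]; cbn; rewrite IH by trivial.
    destruct L; [easy|cbn; lia].
Qed.

Lemma NoDup_remove_entry (L : list nat) (p : nat) :
  NoDup L -> NoDup (remove Nat.eq_dec p L).
Proof.
  intros HL; rewrite <- remove_alt; now apply NoDup_filter.
Qed.

Lemma rank_remove (L : list nat) (p : nat) :
  filter (fun y => (y <? p)%nat) (remove Nat.eq_dec p L) =
  filter (fun y => (y <? p)%nat) L.
Proof.
  induction L as [|y L IH]; [reflexivity|]; cbn [remove filter].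
  destruct (Nat.eq_dec p y) as [->|Hne]; [now rewrite Nat.ltb_irrefl|].
  cbn [filter]; now rewrite IH.
Qed.

(** By induction on the depth: the cost of a call depends only on the lengths of
    the two parts, thus on the rank of the pivot, and the sum over the pivots is
    reindexed by their ranks. *)
Lemma quicksort_comparisons (depth : nat) (L : list nat) (f : nat -> R) :
  NoDup L ->
  expectation (quicksort_rec depth L) (fun r => f (snd r)) =
  expectation (comparisons depth (length L)) f.
Proof.
  revert L f; induction depth as [|depth IH]; intros L f HL;
    cbn [quicksort_rec comparisons].
  { now rewrite !expectation_ret. }
  destruct (length L <=? 1)%nat eqn:E; [now rewrite !expectation_ret|].
  rewrite !expectation_bind, !expectation_uniform, length_seq; f_equal.
  rewrite <- (total_permutation _ _ (Permutation_map _ (rank_permutation L HL))).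
  rewrite map_map; f_equal; apply map_ext_in; intros p Hp.
  pose proof (length_remove L p HL Hp) as Hlen.
  pose proof (NoDup_remove_entry L p HL) as Hnd.
  pose proof (rank_remove L p) as Hrank.
  revert Hlen Hnd Hrank; generalize (remove Nat.eq_dec p L) as others.
  intros others Hlen Hnd Hrank.
  destruct (partition (fun y => (y <? p)%nat) others) as [smaller larger] eqn:Epart.
  pose proof (partition_length _ _ Epart) as Hsum.
  rewrite partition_as_filter in Epart; injection Epart as Es El.
  assert (Hs : length smaller = rank L p) by (now rewrite <- Es, Hrank).
  assert (Hl : length larger = (length L - 1 - rank L p)%nat) by lia.
  rewrite <- Hs, <- Hlen; replace (length others - length smaller)%nat
    with (length larger) by lia.
  assert (NoDup smaller) by (subst; now apply NoDup_filter).
  assert (NoDup larger) by (subst; now apply NoDup_filter).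
  rewrite !expectation_bind, <- (IH smaller) by trivial.
  apply expectation_ext; intros s.
  rewrite !expectation_bind, <- (IH larger) by trivial.
  apply expectation_ext; intros l.
  now rewrite !expectation_ret.
Qed.

Lemma comparisons_depth (depth depth' n : nat) (f : nat -> R) :
  (n <= depth)%nat -> (n <= depth')%nat ->
  expectation (comparisons depth n) f = expectation (comparisons depth' n) f.
Proof.
  revert depth' n f; induction depth as [|depth IH];
    intros [|depth'] n f h h'; cbn [comparisons].
  - reflexivity.
  - now replace n with 0%nat by lia.
  - now replace n with 0%nat by lia.
  - destruct (Nat.leb_spec n 1) as [|Hn]; [reflexivity|].
    rewrite !expectation_bind, !expectation_uniform; do 2 f_equal.
    apply map_ext_in; intros k Hk; apply in_seq in Hk.
    rewrite !expectation_bind, (IH depth') by lia.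
    apply expectation_ext; intros a.
    now rewrite !expectation_bind, (IH depth') by lia.
Qed.

(** [cost_mean n f] is [E[f(X_n)]]. *)
Definition cost_mean (n : nat) : (nat -> R) -> R := expectation (comparisons n n).

Lemma cost_mean_0 (f : nat -> R) : cost_mean 0 f = f O.
Proof. apply expectation_ret. Qed.

Lemma total_seq (g : nat -> R) (n : nat) :
  total (map g (seq 0 (S n))) = sum_f_R0 g n.
Proof.
  induction n as [|n IH]; [cbn; ring|].
  rewrite seq_S, map_app, total_app, IH; cbn; ring.
Qed.

(** The distributional recurrence. A list with a single entry is returned without
    choosing a pivot; it fits in because the toll of a pivot would be 0. *)
Lemma cost_mean_succ (n : nat) (f : nat -> R) :
  INR (S n) * cost_mean (S n) f =
  sum_f_R0 (fun k =>
    cost_mean k (fun a => cost_mean (n - k) (fun b => f (n + a + b)%nat))) n.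
Proof.
  destruct n as [|n].
  { cbn [sum_f_R0]; rewrite !cost_mean_0; cbn; ring. }
  unfold cost_mean at 1; rewrite comparisons_succ by lia.
  rewrite expectation_bind, expectation_uniform, length_seq, total_seq.
  rewrite <- Rmult_assoc, Rinv_r, Rmult_1_l by (apply not_0_INR; lia).
  replace (S (S n) - 1)%nat with (S n) by lia; apply sum_eq; intros k Hk.
  rewrite expectation_bind; unfold cost_mean; rewrite (comparisons_depth (S n) k) by lia.
  apply expectation_ext; intros a.
  rewrite expectation_bind, (comparisons_depth (S n) (S n - k)) by lia.
  apply expectation_ext; intros b; now rewrite expectation_ret.
Qed.

Lemma insertions_permutation {A : Type} (x : A) (l l' : list A) :
  In l' (insertions x l) -> Permutation (x :: l) l'.
Proof.
  revert l'; induction l as [|y l IH]; intros l'; cbn.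
  - intros [<-|[]]; reflexivity.
  - intros [<-|Hin]; [reflexivity|].
    apply in_map_iff in Hin as (l'' & <- & Hin).
    rewrite perm_swap; constructor; auto.
Qed.

Lemma permutations_permutation {A : Type} (l l' : list A) :
  In l' (permutations l) -> Permutation l l'.
Proof.
  revert l'; induction l as [|x l IH]; intros l'; cbn.
  - intros [<-|[]]; reflexivity.
  - intros Hin; apply in_flat_map in Hin as (l'' & Hl & Hin).
    rewrite <- (insertions_permutation x l'' l') by trivial; constructor; auto.
Qed.

Lemma permutations_self {A : Type} (l : list A) : In l (permutations l).
Proof.
  induction l as [|x l IH]; cbn; [now left|].
  apply in_flat_map; exists l; split; trivial; destruct l; now left.
Qed.

(** Every ordering costs the same in law, so averaging over them changes
    nothing. *)
Lemma expectation_X (n : nat) (f : nat -> R) : expectation (X n) f = cost_mean n f.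
Proof.
  unfold X; rewrite expectation_bind, expectation_uniform.
  replace (map _ _) with
    (map (fun _ : list nat => cost_mean n f) (permutations (seq 1 n))).
  - assert (Ht : forall l : list (list nat),
              total (map (fun _ => cost_mean n f) l) = INR (length l) * cost_mean n f).
    { induction l as [|L l IH]; [cbn; ring|]; cbn [length map].
      rewrite S_INR; unfold total in *; cbn; rewrite IH; ring. }
    rewrite Ht, <- Rmult_assoc, Rinv_l, Rmult_1_l; [reflexivity|].
    generalize (permutations_self (seq 1 n)).
    destruct (permutations _); [easy|]; intros _; apply not_0_INR; easy.
  - apply map_ext_in; intros L HL; apply permutations_permutation in HL.
    rewrite expectation_bind.
    transitivity (expectation (quicksort L) (fun r => f (snd r))).
    + unfold quicksort; rewrite quicksort_comparisons.
      * now rewrite <- (Permutation_length HL), length_seq.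
      * apply (Permutation_NoDup HL), seq_NoDup.
    + apply expectation_ext; intros r; now rewrite expectation_ret.
Qed.

(** * Formal power series *)

(** A power series is its sequence of coefficients. Splitting off the constant
    term of the left factor gives the product a recursion under which the ring
    laws and the Leibniz rule are plain inductions. *)
Definition shift (a : nat -> R) : nat -> R := fun n => a (S n).

Fixpoint conv (a b : nat -> R) (n : nat) : R :=
  match n with
  | O => a O * b O
  | S n' => a O * b n + conv (shift a) b n'
  end.

Lemma conv_sum (a b : nat -> R) (n : nat) :
  conv a b n = sum_f_R0 (fun k => a k * b (n - k)%nat) n.
Proof.
  revert a; induction n as [|n IH]; intros a; [reflexivity|].
  rewrite decomp_sum by lia.
  cbn [conv pred]; rewrite IH; reflexivity.
Qed.

Lemma conv_add_l (a a' b : nat -> R) (n : nat) :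
  conv (fun k => a k + a' k) b n = conv a b n + conv a' b n.
Proof.
  revert a a'; induction n as [|n IH]; intros a a'; cbn [conv]; [ring|].
  unfold shift at 1; rewrite IH; unfold shift; ring.
Qed.

Lemma conv_scal_l (x : R) (a b : nat -> R) (n : nat) :
  conv (fun k => x * a k) b n = x * conv a b n.
Proof.
  revert a; induction n as [|n IH]; intros a; cbn [conv]; [ring|].
  unfold shift at 1; rewrite IH; unfold shift; ring.
Qed.

Lemma conv_shift_r (a b : nat -> R) (n : nat) :
  conv a b (S n) = conv a (shift b) n + a (S n) * b O.
Proof.
  revert a; induction n as [|n IH]; intros a; [cbn; unfold shift; ring|].
  change (conv a b (S (S n))) with (a O * b (S (S n)) + conv (shift a) b (S n)).
  rewrite IH; cbn [conv]; unfold shift; ring.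
Qed.

Lemma conv_comm (a b : nat -> R) : conv a b = conv b a.
Proof.
  extensionality n; revert a b; induction n as [|n IH]; intros a b; [cbn; ring|].
  rewrite conv_shift_r, IH; cbn [conv]; unfold shift; ring.
Qed.

Lemma conv_add_r (a b b' : nat -> R) (n : nat) :
  conv a (fun k => b k + b' k) n = conv a b n + conv a b' n.
Proof. rewrite !(conv_comm a); apply conv_add_l. Qed.

Lemma conv_scal_r (x : R) (a b : nat -> R) (n : nat) :
  conv a (fun k => x * b k) n = x * conv a b n.
Proof. rewrite !(conv_comm a); apply conv_scal_l. Qed.

Lemma shift_conv (a b : nat -> R) :
  shift (conv a b) = fun n => a O * shift b n + conv (shift a) b n.
Proof. reflexivity. Qed.

Lemma conv_assoc (a b d : nat -> R) : conv (conv a b) d = conv a (conv b d).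
Proof.
  extensionality n; revert a b d; induction n as [|n IH]; intros a b d; [cbn; ring|].
  cbn [conv]; rewrite shift_conv, conv_add_l, conv_scal_l, IH; ring.
Qed.

(** The derivation [z d/dz]. *)
Definition theta (a : nat -> R) : nat -> R := fun n => INR n * a n.

Lemma theta_conv (a b : nat -> R) :
  theta (conv a b) = fun n => conv (theta a) b n + conv a (theta b) n.
Proof.
  extensionality n; revert a b; induction n as [|n IH]; intros a b;
    [unfold theta; cbn; ring|].
  assert (E : shift (theta a) = fun k => theta (shift a) k + shift a k).
  { extensionality k; unfold theta, shift; rewrite S_INR; ring. }
  specialize (IH (shift a) b); unfold theta at 1 in IH.
  cbn [conv]; rewrite E, conv_add_l.
  change (theta (conv a b) (S n))
    with (INR (S n) * (a O * b (S n) + conv (shift a) b n)).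
  change (theta b (S n)) with (INR (S n) * b (S n)).
  replace (theta a O) with 0 by (unfold theta; cbn; ring).
  rewrite S_INR; lra.
Qed.

(** The series [1], [u = 1/(1-z)] and [L = log (1/(1-z))]. *)
Definition delta (n : nat) : R := match n with O => 1 | S _ => 0 end.
Definition geom (n : nat) : R := 1.
Definition log_series (n : nat) : R := match n with O => 0 | S _ => / INR n end.

Lemma conv_delta_l (b : nat -> R) : conv delta b = b.
Proof.
  extensionality n; destruct n as [|n]; cbn; [ring|].
  replace (shift delta) with (fun k => 0 * delta k)
    by (extensionality k; cbn; unfold shift; ring).
  rewrite conv_scal_l; ring.
Qed.

Lemma conv_geom_S (b : nat -> R) (n : nat) :
  conv geom b (S n) = b (S n) + conv geom b n.
Proof. cbn [conv]; unfold geom at 1; rewrite Rmult_1_l; reflexivity. Qed.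

Lemma theta_geom : theta geom = fun n => conv geom geom n - geom n.
Proof.
  extensionality n; induction n as [|n IH]; [unfold theta; cbn; unfold geom; ring|].
  rewrite conv_geom_S; unfold theta, geom in *; rewrite S_INR; lra.
Qed.

Lemma theta_log : theta log_series = fun n => geom n - delta n.
Proof.
  extensionality n; destruct n as [|n]; [unfold theta; cbn; unfold geom; ring|].
  unfold theta, geom, log_series, delta; field; apply not_0_INR; lia.
Qed.

Fixpoint power (a : nat -> R) (k : nat) : nat -> R :=
  match k with O => delta | S k' => conv a (power a k') end.

Lemma power_add (a : nat -> R) (j k : nat) :
  power a (j + k) = conv (power a j) (power a k).
Proof.
  induction j as [|j IH]; cbn; [now rewrite conv_delta_l|].
  now rewrite IH, conv_assoc.
Qed.

(** The coefficients of [u^j L^k]. *)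
Definition mono (j k : nat) : nat -> R := conv (power geom j) (power log_series k).

Lemma conv_mono (j k j' k' : nat) :
  conv (mono j k) (mono j' k') = mono (j + j') (k + k').
Proof.
  unfold mono; rewrite !power_add, !conv_assoc; f_equal.
  rewrite <- !conv_assoc; f_equal; apply conv_comm.
Qed.

Lemma theta_power (a : nat -> R) (k : nat) :
  theta (power a k) = fun n => INR k * conv (power a (pred k)) (theta a) n.
Proof.
  extensionality n; revert n; induction k as [|k IH]; intros n.
  - unfold theta; cbn; destruct n; cbn; ring.
  - cbn [power pred]; rewrite theta_conv.
    apply functional_extensionality in IH.
    rewrite IH, conv_scal_r, (conv_comm (theta a)), S_INR.
    destruct k as [|k]; [cbn [INR]; ring|].
    cbn [pred power]; rewrite conv_assoc; ring.
Qed.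

Lemma conv_sub_r (a b b' : nat -> R) (n : nat) :
  conv a (fun k => b k - b' k) n = conv a b n - conv a b' n.
Proof.
  replace (fun k => b k - b' k) with (fun k => b k + -1 * b' k)
    by (extensionality k; ring).
  rewrite conv_add_r, conv_scal_r; ring.
Qed.

Lemma theta_power_geom (j : nat) :
  theta (power geom j) = fun n => INR j * (power geom (S j) n - power geom j n).
Proof.
  extensionality n; rewrite theta_power, theta_geom, conv_sub_r.
  destruct j as [|j]; [cbn [INR]; ring|].
  cbn [pred power]; rewrite (conv_comm _ (conv geom geom)), conv_assoc.
  now rewrite (conv_comm _ geom).
Qed.

Lemma theta_power_log (k : nat) :
  theta (power log_series k) = fun n =>
    INR k * (conv geom (power log_series (pred k)) n
             - power log_series (pred k) n).
Proof.
  extensionality n; rewrite theta_power, theta_log, conv_sub_r.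
  now rewrite !(conv_comm (power _ _)), conv_delta_l.
Qed.

(** From [theta u = u^2 - u] and [theta L = u - 1]. *)
Lemma theta_mono (j k n : nat) :
  theta (mono j k) n =
    INR j * (mono (S j) k n - mono j k n)
    + INR k * (mono (S j) (pred k) n - mono j (pred k) n).
Proof.
  unfold mono at 1; rewrite theta_conv, theta_power_geom, theta_power_log.
  rewrite conv_scal_l, conv_scal_r, conv_sub_r.
  rewrite (conv_comm _ (power log_series k)), conv_sub_r.
  rewrite !(conv_comm (power log_series k)), <- conv_assoc.
  rewrite (conv_comm (power geom j) geom); reflexivity.
Qed.

(** The derivative of [u^j L^k], from [u' = u^2] and [L' = u]. It is
    deduced from [theta_mono]: since [z u = u - 1], the difference of the
    coefficients of [u F] at [n + 1] and of [F] at [n + 1] is the coefficient of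
    [u F] at [n]. *)
Lemma mono_succ (j k n : nat) :
  INR (S n) * mono j k (S n) =
    INR j * mono (S j) k n + INR k * mono (S j) (pred k) n.
Proof.
  assert (E : forall i, mono (S j) i (S n) = mono j i (S n) + mono (S j) i n).
  { intros i; unfold mono; cbn [power]; rewrite !conv_assoc; apply conv_geom_S. }
  change (theta (mono j k) (S n) =
    INR j * mono (S j) k n + INR k * mono (S j) (pred k) n).
  rewrite theta_mono, !E; ring.
Qed.

(** * The coefficients of powers of the logarithm *)

(** The coefficient of [z^n] in [u exp(t L) = (1-z)^(-1-t)] is the product of
    the [1 + t/i] for [i = 1, ..., n]; so that of [u L^k] is [k!] times the
    [k]-th elementary symmetric polynomial of [1, 1/2, ..., 1/n]. *)
Definition esym (k : nat) : nat -> R := mono 1 k.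

(** Elimination of [u^2 L^k] between its derivative form at [n + 1] and its
    [theta] form at [n]. *)
Lemma esym_succ (k n : nat) :
  INR (S n) * esym k (S n) = INR (S n) * esym k n + INR k * esym (pred k) n.
Proof.
  unfold esym; rewrite mono_succ.
  pose proof (theta_mono 1 k n) as E; unfold theta in E.
  rewrite (S_INR n); change (INR 1) with 1 in *; lra.
Qed.

Lemma H_succ (s n : nat) : H s (S n) = H s n + / INR (S n) ^ s.
Proof. unfold H; rewrite sum_n_Sm by lia; reflexivity. Qed.

Lemma H_0 (s : nat) : H s 0 = 0.
Proof. unfold H; rewrite sum_n_m_zero by lia; reflexivity. Qed.

Lemma esym_at_0 (k : nat) : esym (S k) 0 = 0.
Proof. unfold esym, mono; cbn; ring. Qed.

Lemma esym_step (k n : nat) :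
  esym (S k) (S n) = esym (S k) n + INR (S k) * / INR (S n) * esym k n.
Proof.
  pose proof (esym_succ (S k) n) as E; cbn [pred] in E.
  assert (INR (S n) <> 0) by (apply not_0_INR; lia).
  apply (Rmult_eq_reg_l (INR (S n))); [rewrite E; field|]; assumption.
Qed.

(** Newton's identities, verified by adding the variable [1/(n+1)]: both sides
    then obey [esym_step]. *)
Lemma esym_harmonic (n : nat) :
  let h s := H s n in
  esym 0 n = 1 /\ esym 1 n = h 1%nat /\ esym 2 n = h 1%nat ^ 2 - h 2%nat
  /\ esym 3 n = h 1%nat ^ 3 - 3 * h 1%nat * h 2%nat + 2 * h 3%nat
  /\ esym 4 n = h 1%nat ^ 4 - 6 * h 1%nat ^ 2 * h 2%nat + 3 * h 2%nat ^ 2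
             + 8 * h 1%nat * h 3%nat - 6 * h 4%nat
  /\ esym 5 n = h 1%nat ^ 5 - 10 * h 1%nat ^ 3 * h 2%nat + 15 * h 1%nat * h 2%nat ^ 2
             + 20 * h 1%nat ^ 2 * h 3%nat - 20 * h 2%nat * h 3%nat
             - 30 * h 1%nat * h 4%nat + 24 * h 5%nat
  /\ esym 6 n = h 1%nat ^ 6 - 15 * h 1%nat ^ 4 * h 2%nat + 45 * h 1%nat ^ 2 * h 2%nat ^ 2
             - 15 * h 2%nat ^ 3 + 40 * h 1%nat ^ 3 * h 3%nat
             - 120 * h 1%nat * h 2%nat * h 3%nat + 40 * h 3%nat ^ 2
             - 90 * h 1%nat ^ 2 * h 4%nat + 90 * h 2%nat * h 4%nat
             + 144 * h 1%nat * h 5%nat - 120 * h 6%nat.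
Proof.
  cbv zeta; induction n as [|n (E0 & E1 & E2 & E3 & E4 & E5 & E6)].
  - rewrite !H_0, !esym_at_0; unfold esym, mono; cbn; unfold geom; repeat split; ring.
  - assert (E0' : esym 0 (S n) = 1).
    { pose proof (esym_succ 0 n) as E; change (INR 0) with 0 in E. rewrite E0 in E.
      apply (Rmult_eq_reg_l (INR (S n))); [lra|apply not_0_INR; lia]. }
    split; [exact E0'|].
    rewrite !esym_step, !H_succ, E0, E1, E2, E3, E4, E5, E6.
    rewrite <- !pow_inv; set (w := / INR (S n)); cbn [INR]; repeat split; ring.
Qed.

(** * Computing with integer combinations of monomials *)

(** A list of coefficients and monomials, in which a monomial may occur several
    times; [eval w] gives the monomials their values. Operations on combinations
    are linear extensions of their effect on one monomial, and [collect] brings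
    equal monomials together, so that identities can be decided by
    computation. *)
Definition combination (K : Type) : Type := list (Z * K).

Definition eval {K : Type} (w : K -> R) (p : combination K) : R :=
  fold_right (fun t s => IZR (fst t) * w (snd t) + s) 0 p.

Definition scale {K : Type} (z : Z) (p : combination K) : combination K :=
  map (fun t => ((z * fst t)%Z, snd t)) p.

Definition linear_extension {K K' : Type} (f : K -> combination K') (p : combination K) :
  combination K' :=
  flat_map (fun t => scale (fst t) (f (snd t))) p.

Fixpoint insert {K : Type} (dec : forall x y : K, {x = y} + {x <> y})
    (z : Z) (k : K) (p : combination K) : combination K :=
  match p with
  | [] => [(z, k)]
  | (z', k') :: q =>
      if dec k k' then ((z + z')%Z, k') :: q else (z', k') :: insert dec z k q
  end.

Definition collect {K : Type} (dec : forall x y : K, {x = y} + {x <> y})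
    (p : combination K) : combination K :=
  fold_right (fun t q => insert dec (fst t) (snd t) q) [] p.

Lemma eval_app {K : Type} (w : K -> R) (p q : combination K) :
  eval w (p ++ q) = eval w p + eval w q.
Proof.
  unfold eval; induction p as [|t p IH]; cbn; [ring|rewrite IH; ring].
Qed.

Lemma eval_scale {K : Type} (w : K -> R) (z : Z) (p : combination K) :
  eval w (scale z p) = IZR z * eval w p.
Proof.
  unfold eval, scale; induction p as [|t p IH]; cbn; [ring|].
  rewrite IH, mult_IZR; ring.
Qed.

Lemma eval_linear_extension {K K' : Type} (w : K' -> R) (f : K -> combination K')
    (p : combination K) :
  eval w (linear_extension f p) = eval (fun k => eval w (f k)) p.
Proof.
  induction p as [|t p IH]; [reflexivity|].
  unfold linear_extension in *; cbn [flat_map].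
  rewrite eval_app, eval_scale, IH; reflexivity.
Qed.

Lemma eval_insert {K : Type} dec (w : K -> R) (z : Z) (k : K) (p : combination K) :
  eval w (insert dec z k p) = IZR z * w k + eval w p.
Proof.
  unfold eval; induction p as [|[z' k'] p IH]; cbn; [reflexivity|].
  destruct (dec k k') as [<-|_]; cbn; [rewrite plus_IZR|rewrite IH]; ring.
Qed.

Lemma eval_collect {K : Type} dec (w : K -> R) (p : combination K) :
  eval w (collect dec p) = eval w p.
Proof.
  induction p as [|t p IH]; [reflexivity|].
  cbn [collect fold_right]; rewrite eval_insert.
  change (fold_right _ _ p) with (collect dec p); now rewrite IH.
Qed.

Lemma eval_ext {K : Type} (w w' : K -> R) (p : combination K) :
  (forall k, w k = w' k) -> eval w p = eval w' p.
Proof. intros h; now replace w' with w by now extensionality k. Qed.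

Lemma eval_ext_in {K : Type} (w w' : K -> R) (p : combination K) :
  (forall t, In t p -> w (snd t) = w' (snd t)) -> eval w p = eval w' p.
Proof.
  unfold eval; induction p as [|t p IH]; intros h; [reflexivity|]; cbn.
  rewrite IH by (intros; apply h; now right); now rewrite h by now left.
Qed.

Lemma eval_mult {K : Type} (x : R) (w : K -> R) (p : combination K) :
  eval (fun k => x * w k) p = x * eval w p.
Proof.
  unfold eval; induction p as [|t p IH]; cbn; [ring|rewrite IH; ring].
Qed.

Lemma eval_zero {K : Type} dec (w : K -> R) (p : combination K) :
  forallb (fun t => (fst t =? 0)%Z) (collect dec p) = true -> eval w p = 0.
Proof.
  rewrite <- (eval_collect dec); generalize (collect dec p) as q; intros q.
  unfold eval; induction q as [|[z k] q IH]; cbn; [reflexivity|].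
  intros [h h']%andb_prop; apply Z.eqb_eq in h as ->.
  rewrite IH by trivial; ring.
Qed.

Lemma conv_eval_l {K : Type} (s : K -> nat -> R) (b : nat -> R)
    (p : combination K) (n : nat) :
  conv (fun i => eval (fun k => s k i) p) b n = eval (fun k => conv (s k) b n) p.
Proof.
  unfold eval; induction p as [|t p IH]; cbn [fold_right].
  - transitivity (conv (fun i => 0 * b i) b n); [f_equal; extensionality i; ring|].
    rewrite conv_scal_l; ring.
  - rewrite conv_add_l, conv_scal_l, IH; reflexivity.
Qed.

Lemma expectation_eval {K A : Type} (d : fdist A) (w : K -> A -> R)
    (p : combination K) :
  expectation d (fun a => eval (fun k => w k a) p) =
  eval (fun k => expectation d (w k)) p.
Proof.
  unfold eval; induction p as [|t p IH]; cbn [fold_right].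
  - transitivity (expectation d (fun _ => 0 * 0)).
    + apply expectation_ext; intros a; ring.
    + rewrite expectation_scal; ring.
  - rewrite expectation_plus, expectation_scal, IH; reflexivity.
Qed.

Lemma sum_eval {K : Type} (w : K -> nat -> R) (p : combination K) (n : nat) :
  sum_f_R0 (fun i => eval (fun k => w k i) p) n = eval (fun k => sum_f_R0 (w k) n) p.
Proof.
  unfold eval; induction p as [|t p IH]; cbn [fold_right].
  - apply sum_eq_R0; reflexivity.
  - rewrite plus_sum, IH, scal_sum; f_equal; apply sum_eq; intros; ring.
Qed.

Definition pair_dec : forall x y : nat * nat, {x = y} + {x <> y}.
Proof. decide equality; apply Nat.eq_dec. Defined.

Definition triple_dec : forall x y : nat * (nat * nat), {x = y} + {x <> y}.
Proof. decide equality; [apply pair_dec|apply Nat.eq_dec]. Defined.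

(** The power series of a combination of the monomials [u^j L^k], with
    [(j, k)] for [u^j L^k]. *)
Definition series (p : combination (nat * nat)) (n : nat) : R :=
  eval (fun jk => mono (fst jk) (snd jk) n) p.

Definition formal_product (p q : combination (nat * nat)) : combination (nat * nat) :=
  collect pair_dec
    (linear_extension (fun jk =>
      map (fun t => (fst t, (fst jk + fst (snd t), snd jk + snd (snd t))%nat)) q) p).

Definition formal_derivative (p : combination (nat * nat)) : combination (nat * nat) :=
  linear_extension (fun '(j, k) =>
    [(Z.of_nat j, (S j, k)); (Z.of_nat k, (S j, pred k))]) p.

Definition formal_theta (p : combination (nat * nat)) : combination (nat * nat) :=
  collect pair_dec
    (linear_extension (fun '(j, k) =>
      [(Z.of_nat j, (S j, k)); ((- Z.of_nat j)%Z, (j, k));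
       (Z.of_nat k, (S j, pred k)); ((- Z.of_nat k)%Z, (j, pred k))]) p).

Lemma series_formal_product (p q : combination (nat * nat)) (n : nat) :
  series (formal_product p q) n = conv (series p) (series q) n.
Proof.
  unfold series at 1, formal_product; rewrite eval_collect, eval_linear_extension.
  unfold series at 1; rewrite conv_eval_l; apply eval_ext; intros [j k]; cbn [fst snd].
  rewrite conv_comm; unfold series; rewrite conv_eval_l.
  unfold eval; induction q as [|[z [j' k']] q IH]; [reflexivity|].
  cbn [map fold_right fst snd].
  rewrite IH, conv_mono, (Nat.add_comm j'), (Nat.add_comm k').
  reflexivity.
Qed.

Lemma series_formal_derivative (p : combination (nat * nat)) (n : nat) :
  series (formal_derivative p) n = INR (S n) * series p (S n).
Proof.
  unfold series, formal_derivative; rewrite eval_linear_extension, <- eval_mult.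
  apply eval_ext; intros [j k]; unfold eval; cbn [fold_right fst snd].
  rewrite mono_succ, !INR_IZR_INZ; ring.
Qed.

Lemma series_formal_theta (p : combination (nat * nat)) (n : nat) :
  series (formal_theta p) n = INR n * series p n.
Proof.
  unfold series, formal_theta; rewrite eval_collect, eval_linear_extension, <- eval_mult.
  apply eval_ext; intros [j k]; unfold eval; cbn [fold_right fst snd].
  change (INR n * mono j k n) with (theta (mono j k) n).
  rewrite theta_mono, !opp_IZR, !INR_IZR_INZ; ring.
Qed.

(** The expansion of [(x + y + z)^r], with [(i, (j, k))] for [x^i y^j z^k]. *)
Fixpoint trinomial (r : nat) : combination (nat * (nat * nat)) :=
  match r with
  | O => [(1%Z, (0, (0, 0)))%nat]
  | S r' =>
      collect triple_dec
        (linear_extension (fun '(i, (j, k)) =>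
          [(1%Z, (S i, (j, k))); (1%Z, (i, (S j, k))); (1%Z, (i, (j, S k)))])
          (trinomial r'))
  end.

Lemma trinomial_power (r : nat) (x y z : R) :
  (x + y + z) ^ r =
  eval (fun '(i, (j, k)) => x ^ i * (y ^ j * z ^ k)) (trinomial r).
Proof.
  induction r as [|r IH]; [cbn; ring|].
  cbn [trinomial pow]; rewrite IH, eval_collect, eval_linear_extension, <- eval_mult.
  apply eval_ext; intros (i & j & k); unfold eval; cbn [fold_right fst snd pow]; ring.
Qed.

(** * The moments of the shifted cost *)

(** The row [k] of the entry [r] lists the coefficients [q_0, q_1, ...] such that
    [2700 E[Y_n^r]] is the sum over [k] of [(q_0 + q_1 n + ...) esym k n]. The
    numbers come from solving the differential equations for [P_0, ..., P_6]
    successively: given [P_j] for [j < r], the equation for [P_r] reads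
    [(P_r / u^2)' = S / u^2] with a known [S], which is integrated term by term
    with [(u^j L^k)' = j u^(j+1) L^k + k u^(j+1) L^(k-1)], and the solution is
    then rewritten in the series [theta^i (u L^k)]. The factor 2700 clears all
    denominators. *)
Definition moment_table : list (list (list Z)) :=
[
  [[2700]];
  [[0; -5400];
   [5400; 5400]];
  [[0; 35100; 29700];
   [-5400; -27000; -21600];
   [10800; 21600; 10800]];
  [[0; -280800; -429300; -186300];
   [37800; 280800; 421200; 178200];
   [-32400; -129600; -162000; -64800];
   [21600; 64800; 64800; 21600]];
  [[0; 3407100; 6895500; 5489400; 1585200];
   [-415800; -3385800; -6760800; -5281200; -1490400];
   [334800; 1771200; 3250800; 2527200; 712800];
   [-129600; -561600; -907200; -648000; -172800];
   [43200; 172800; 259200; 172800; 43200]];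
  [[0; -55444850; -131967625; -142756125; -76080875; -16170925];
   [6323400; 55082400; 130458000; 140319000; 74472000; 15852000];
   [-4914000; -28620000; -63234000; -67716000; -35640000; -7452000];
   [1836000; 9612000; 20196000; 21276000; 11232000; 2376000];
   [-432000; -2160000; -4320000; -4320000; -2160000; -432000];
   [86400; 432000; 864000; 864000; 432000; 86400]];
  [[0; 1133389148; 3008008458; 3950954245; 2923850225; 1167417507; 196733617];
   [-123168600; -1126305600; -2982424500; -3909207000; -2890446000; -1154577600; -194051100];
   [93646800; 583365600; 1457794800; 1914156000; 1415268000; 564300000; 95112000];
   [-34344000; -195264000; -469800000; -611064000; -451872000; -179496000; -29808000];
   [7992000; 45576000; 109512000; 142128000; 105192000; 42120000; 7128000];
   [-1296000; -7516800; -18144000; -23328000; -16848000; -6480000; -1036800];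
   [172800; 1036800; 2592000; 3456000; 2592000; 1036800; 172800]]
]%Z.

Definition horner (row : list Z) (x : R) : R :=
  fold_right (fun z s => IZR z + x * s) 0 row.

Fixpoint tabulated (k : nat) (rows : list (list Z)) (n : nat) : R :=
  match rows with
  | [] => 0
  | row :: rows' => horner row (INR n) * esym k n + tabulated (S k) rows' n
  end.

(** The sum over [k] and [i] of [q_i theta^i (u L^k)], by Horner's rule in
    [theta], as a polynomial in [u] and [L]. *)
Fixpoint expand (k : nat) (rows : list (list Z)) : combination (nat * nat) :=
  match rows with
  | [] => []
  | row :: rows' =>
      fold_right (fun z p => (z, (1%nat, k)) :: formal_theta p) [] row
      ++ expand (S k) rows'
  end.

Lemma series_expand (k : nat) (rows : list (list Z)) (n : nat) :
  series (expand k rows) n = tabulated k rows n.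
Proof.
  revert k; induction rows as [|row rows IH]; intros k; [reflexivity|].
  cbn [expand tabulated]; unfold series; rewrite eval_app.
  change (eval _ (expand (S k) rows)) with (series (expand (S k) rows) n).
  rewrite IH; f_equal.
  induction row as [|z row IHrow]; [cbn; ring|].
  cbn [fold_right horner]; unfold eval; cbn [fold_right fst snd].
  change (fold_right _ 0 (formal_theta ?p)) with (series (formal_theta p) n).
  rewrite series_formal_theta; unfold series; rewrite IHrow; unfold horner, esym; ring.
Qed.

Definition generating_function (r : nat) : combination (nat * nat) :=
  collect pair_dec (expand 0 (nth r moment_table [])).

(** The toll [n + 1] of [Y_n], at the coefficient of [z^(n-1)], is
    [theta + 2]. *)
Definition toll_operator (p : combination (nat * nat)) : combination (nat * nat) :=
  collect pair_dec (formal_theta p ++ scale 2 p).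

Definition toll_side (r : nat) : combination (nat * nat) :=
  linear_extension (fun '(i, (j, k)) =>
    Nat.iter i toll_operator
      (formal_product (generating_function j) (generating_function k)))
    (trinomial r).

(** With [p_r = 2700 P_r], the differential equation for [P_r] is
    [2700 p_r' = toll_side r]. *)
Definition solves_equation (r : nat) : bool :=
  forallb (fun t => (fst t =? 0)%Z)
    (collect pair_dec
       (scale 2700 (formal_derivative (generating_function r))
        ++ scale (-1) (toll_side r))).

Lemma equations_solved : forallb solves_equation (seq 0 7) = true.
Proof. vm_compute; reflexivity. Qed.

(** The moment [E[Y_n^r]]. The shift by [2 n] turns the toll [n - 1] into
    [n + 1], for which the equation of [P_1] is [(P_1 / u^2)' = 2 u]; hence
    [P_1 = 2 u^2 L]. *)
Definition moment (r n : nat) : R := cost_mean n (fun k => (INR k + 2 * INR n) ^ r).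

Lemma expectation_product {A B : Type} (d : fdist A) (e : fdist B) (x : R)
    (f : A -> R) (g : B -> R) :
  expectation d (fun a => expectation e (fun b => x * (f a * g b))) =
  x * (expectation d f * expectation e g).
Proof.
  transitivity (expectation d (fun a => x * expectation e g * f a)).
  - apply expectation_ext; intros a; rewrite !expectation_scal; ring.
  - rewrite expectation_scal; ring.
Qed.

(** For a pivot of rank [d] among [n + 1] entries, the shifted cost is the sum of
    the toll [n + 2] and of the shifted costs of parts of lengths [d] and
    [n - d], which are independent: the trinomial expansion of its [r]-th power
    averages to products of moments. *)
Lemma moment_succ (r n : nat) :
  INR (S n) * moment r (S n) =
  eval (fun '(i, (j, k)) => (INR n + 2) ^ i * conv (moment j) (moment k) n)
    (trinomial r).
Proof.
  unfold moment at 1; rewrite cost_mean_succ.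
  transitivity (sum_f_R0 (fun d =>
    eval (fun '(i, (j, k)) => (INR n + 2) ^ i * (moment j d * moment k (n - d)%nat))
      (trinomial r)) n).
  - apply sum_eq; intros d Hd.
    transitivity (eval (fun t => cost_mean d (fun a => cost_mean (n - d) (fun b =>
      (INR n + 2) ^ fst t * ((INR a + 2 * INR d) ^ fst (snd t)
        * (INR b + 2 * INR (n - d)) ^ snd (snd t))))) (trinomial r)).
    + unfold cost_mean; rewrite <- expectation_eval; apply expectation_ext; intros a.
      rewrite <- expectation_eval; apply expectation_ext; intros b.
      replace (INR (n + a + b) + 2 * INR (S n)) with
        ((INR n + 2) + (INR a + 2 * INR d) + (INR b + 2 * INR (n - d)))
        by (rewrite !plus_INR, S_INR, minus_INR by lia; ring).
      rewrite trinomial_power; apply eval_ext; intros (i & j & k); reflexivity.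
    + apply eval_ext; intros (i & j & k); cbn [fst snd].
      apply expectation_product.
  - rewrite (sum_eq _ (fun d => eval (fun t => (INR n + 2) ^ fst t
      * (moment (fst (snd t)) d * moment (snd (snd t)) (n - d)%nat)) (trinomial r))).
    + rewrite sum_eval; apply eval_ext; intros (i & j & k); cbn [fst snd].
      rewrite conv_sum, scal_sum; apply sum_eq; intros; ring.
    + intros d _; apply eval_ext; intros (i & j & k); reflexivity.
Qed.

Lemma conv_ext (a a' b b' : nat -> R) (n : nat) :
  (forall k, (k <= n)%nat -> a k = a' k /\ b k = b' k) ->
  conv a b n = conv a' b' n.
Proof.
  intros h; rewrite !conv_sum; apply sum_eq; intros k Hk.
  f_equal; apply h; lia.
Qed.

Lemma conv_mult (x y : R) (a b : nat -> R) (n : nat) :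
  conv (fun k => x * a k) (fun k => y * b k) n = x * y * conv a b n.
Proof. rewrite (conv_scal_l x a), (conv_scal_r y a b); ring. Qed.

Lemma series_toll (i : nat) (p : combination (nat * nat)) (n : nat) :
  series (Nat.iter i toll_operator p) n = (INR n + 2) ^ i * series p n.
Proof.
  induction i as [|i IH]; [cbn [Nat.iter nat_rect pow]; ring|].
  change (Nat.iter (S i) toll_operator p)
    with (toll_operator (Nat.iter i toll_operator p)).
  revert IH; generalize (Nat.iter i toll_operator p) as q; intros q IH.
  unfold toll_operator, series; rewrite eval_collect, eval_app, eval_scale.
  change (series (formal_theta q) n + 2 * series q n = (INR n + 2) ^ S i * series p n).
  rewrite series_formal_theta, IH; cbn [pow]; ring.
Qed.

Lemma generating_function_equation (r n : nat) :
  (r <= 6)%nat ->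
  2700 * (INR (S n) * series (generating_function r) (S n)) =
  eval (fun '(i, (j, k)) => (INR n + 2) ^ i
     * conv (series (generating_function j)) (series (generating_function k)) n)
    (trinomial r).
Proof.
  intros Hr.
  assert (h : solves_equation r = true).
  { apply (proj1 (forallb_forall _ _) equations_solved), in_seq; lia. }
  unfold solves_equation in h.
  apply (eval_zero pair_dec (fun jk => mono (fst jk) (snd jk) n)) in h.
  rewrite eval_app, !eval_scale in h.
  change (2700 * series (formal_derivative (generating_function r)) n
          + -1 * series (toll_side r) n = 0) in h.
  rewrite series_formal_derivative in h.
  transitivity (series (toll_side r) n); [lra|].
  unfold toll_side, series; rewrite eval_linear_extension.
  apply eval_ext; intros (i & j & k).
  change (series (Nat.iter i toll_operator
            (formal_product (generating_function j) (generating_function k))) n =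
     (INR n + 2) ^ i
     * conv (series (generating_function j)) (series (generating_function k)) n).
  now rewrite series_toll, series_formal_product.
Qed.

(** The table stops at [r = 6], so the equations must not refer to moments
    beyond it. *)
Lemma trinomial_le (r : nat) (t : Z * (nat * (nat * nat))) :
  (r <= 6)%nat -> In t (trinomial r) ->
  (fst (snd (snd t)) <= 6 /\ snd (snd (snd t)) <= 6)%nat.
Proof.
  intros Hr Ht.
  assert (h : forallb (fun r => forallb (fun t =>
      andb (fst (snd (snd t)) <=? 6)%nat (snd (snd (snd t)) <=? 6)%nat)
      (trinomial r)) (seq 0 7) = true)
    by (vm_compute; reflexivity).
  apply (proj1 (forallb_forall _ _)) with (x := r) in h; [|apply in_seq; lia].
  apply (proj1 (forallb_forall _ _)) with (x := t) in h; [|assumption].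
  apply andb_prop in h as [h h']; split; now apply Nat.leb_le.
Qed.

Lemma generating_function_tabulated (r n : nat) :
  series (generating_function r) n = tabulated 0 (nth r moment_table []) n.
Proof.
  unfold generating_function; rewrite <- series_expand; unfold series.
  apply eval_collect.
Qed.

(** The moments and the tabulated series start alike, and for both the equation
    expresses the coefficient at [n + 1] by those up to [n]; the
    induction on [n] has to treat all [r <= 6] together because the equation
    for [r] involves every lower moment. *)
Lemma moment_generating_function (r n : nat) :
  (r <= 6)%nat -> 2700 * moment r n = series (generating_function r) n.
Proof.
  revert r; induction n as [n IH] using lt_wf_ind; intros r Hr.
  destruct n as [|n].
  - rewrite generating_function_tabulated; unfold moment; rewrite cost_mean_0.
    assert (T00 : esym 0 0 = 1) by (apply (esym_harmonic 0)).
    do 7 (destruct r as [|r];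
      [cbn [nth moment_table tabulated horner fold_right];
       rewrite ?T00, ?esym_at_0; cbn [INR pow]; ring|]).
    lia.
  - apply (Rmult_eq_reg_l (2700 * INR (S n)));
      [|apply Rmult_integral_contrapositive; split; [lra|apply not_0_INR; lia]].
    transitivity (2700 * 2700 * (INR (S n) * moment r (S n))); [ring|].
    rewrite (Rmult_assoc 2700 (INR _)), generating_function_equation, moment_succ,
      <- eval_mult by trivial.
    apply eval_ext_in; intros [z (i & j & k)] Ht; cbn [fst snd].
    apply trinomial_le in Ht; [cbn [fst snd] in Ht|trivial].
    rewrite (conv_ext (series (generating_function j)) (fun d => 2700 * moment j d)
      (series (generating_function k)) (fun d => 2700 * moment k d)).
    + rewrite conv_mult; ring.
    + intros d Hd; split; symmetry; apply IH; lia.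
Qed.

Lemma moment_tabulated (r n : nat) :
  (r <= 6)%nat -> moment r n = tabulated 0 (nth r moment_table []) n / 2700.
Proof.
  intros Hr; rewrite <- generating_function_tabulated.
  rewrite <- moment_generating_function by trivial; field.
Qed.

Lemma expectation_sum {A : Type} (d : fdist A) (f : nat -> A -> R) (n : nat) :
  expectation d (fun a => sum_f_R0 (fun i => f i a) n) =
  sum_f_R0 (fun i => expectation d (f i)) n.
Proof.
  induction n as [|n IH]; [reflexivity|].
  cbn [sum_f_R0]; now rewrite expectation_plus, IH.
Qed.

Lemma moment_0 (n : nat) : moment 0 n = 1.
Proof.
  rewrite moment_tabulated by lia.
  cbn [nth moment_table tabulated horner fold_right].
  rewrite (proj1 (esym_harmonic n)); field.
Qed.

Lemma mean_shifted (n : nat) : moment 1 n = c n + 2 * INR n.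
Proof.
  unfold c; rewrite expectation_X; unfold moment, cost_mean.
  transitivity (expectation (comparisons n n) (fun k => INR k + 2 * INR n * 1)).
  - apply expectation_ext; intros k; ring.
  - rewrite expectation_plus, expectation_scal.
    pose proof (moment_0 n) as h; unfold moment, cost_mean in h; cbn [pow] in h.
    rewrite h; ring.
Qed.

(** [X_n] and [Y_n] differ by a constant, so they have the same moments about the
    mean. *)
Lemma central_moment (r n : nat) :
  m r n =
  sum_f_R0 (fun i => Binomial.C r i * (- moment 1 n) ^ (r - i) * moment i n) r.
Proof.
  unfold m; rewrite expectation_X.
  transitivity (cost_mean n (fun k => sum_f_R0 (fun i =>
    Binomial.C r i * (- moment 1 n) ^ (r - i) * (INR k + 2 * INR n) ^ i) r)).
  - apply expectation_ext; intros k.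
    replace (INR k - c n) with ((INR k + 2 * INR n) + - moment 1 n)
      by (rewrite mean_shifted; ring).
    rewrite binomial; apply sum_eq; intros; ring.
  - unfold cost_mean at 1; rewrite (expectation_sum _ (fun i k =>
      Binomial.C r i * (- moment 1 n) ^ (r - i) * (INR k + 2 * INR n) ^ i)).
    apply sum_eq; intros i _; now rewrite expectation_scal.
Qed.

(** * Limits of polynomial expressions *)

Lemma is_lim_seq_power (u : nat -> R) (l : R) (k : nat) :
  is_lim_seq u l -> is_lim_seq (fun n => u n ^ k) (l ^ k).
Proof.
  intros h; induction k as [|k IH]; [apply is_lim_seq_const|].
  now apply (is_lim_seq_mult' u (fun n => u n ^ k)).
Qed.

Lemma is_lim_seq_value (u : nat -> R) (l l' : R) :
  is_lim_seq u l -> l = l' -> is_lim_seq u l'.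
Proof. now intros h <-. Qed.

(** Follows the shape of the expression down to the hypotheses; the limit, left
    as an existential variable, is built by unification and simplified
    afterwards. *)
Ltac polynomial_limit :=
  lazymatch goal with
  | |- is_lim_seq (fun _ => ?a) _ => apply is_lim_seq_const
  | |- is_lim_seq (fun n => ?a ^ n) _ => eassumption
  | |- is_lim_seq (fun n => @?u n + @?v n) _ =>
      eapply (is_lim_seq_plus' u v); polynomial_limit
  | |- is_lim_seq (fun n => @?u n - @?v n) _ =>
      eapply (is_lim_seq_minus' u v); polynomial_limit
  | |- is_lim_seq (fun n => @?u n * @?v n) _ =>
      eapply (is_lim_seq_mult' u v); polynomial_limit
  | |- is_lim_seq (fun n => @?u n ^ ?k) _ =>
      eapply (is_lim_seq_power u _ k); polynomial_limit
  | |- _ => eassumption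
  end.

(** * Values of zeta at even integers *)

Definition sum_below (f : nat -> R) (n : nat) : R := total (map f (seq 0 n)).

Lemma sum_below_succ (f : nat -> R) (n : nat) :
  sum_below f (S n) = sum_below f n + f n.
Proof.
  unfold sum_below; rewrite seq_S, map_app, total_app; cbn; ring.
Qed.

Lemma sum_below_le (f g : nat -> R) (n : nat) :
  (forall k, (k < n)%nat -> f k <= g k) -> sum_below f n <= sum_below g n.
Proof.
  induction n as [|n IH]; intros h; [apply Rle_refl|].
  rewrite !sum_below_succ; apply Rplus_le_compat; auto.
Qed.

Lemma sum_below_ext (f g : nat -> R) (n : nat) :
  (forall k, (k < n)%nat -> f k = g k) -> sum_below f n = sum_below g n.
Proof.
  intros h; apply Rle_antisym; apply sum_below_le; intros k Hk; rewrite h by trivial;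
    apply Rle_refl.
Qed.

Lemma sum_below_linear (x y : R) (f g : nat -> R) (n : nat) :
  sum_below (fun k => x * f k + y * g k) n = x * sum_below f n + y * sum_below g n.
Proof.
  induction n as [|n IH]; [cbn; ring|]; rewrite !sum_below_succ, IH; ring.
Qed.

Lemma sum_below_fold (f : nat -> R) (n : nat) :
  sum_below f (n + n) = sum_below (fun k => f k + f (n + n - 1 - k)%nat) n.
Proof.
  assert (Hrev : forall a m, rev (seq a m) = map (fun k => a + m - 1 - k)%nat (seq 0 m)).
  { intros a m; induction m as [|m IH]; [reflexivity|].
    rewrite seq_S, rev_app_distr, IH; cbn [seq map rev app].
    f_equal; [lia|].
    rewrite <- seq_shift, map_map; apply map_ext; intros k; lia. }
  unfold sum_below at 1; rewrite seq_app, map_app, total_app.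
  rewrite (total_permutation (map f (seq (0 + n) n)) (map f (rev (seq (0 + n) n))))
    by apply Permutation_map, Permutation_rev.
  rewrite Hrev, map_map; cbn [Nat.add].
  change (sum_below f n + sum_below (fun k => f (n + n - 1 - k)%nat) n =
          sum_below (fun k => f k + f (n + n - 1 - k)%nat) n).
  transitivity (sum_below (fun k => 1 * f k + 1 * f (n + n - 1 - k)%nat) n).
  - rewrite sum_below_linear; ring.
  - apply sum_below_ext; intros; ring.
Qed.

(** The odd multiples of [PI / 2^(n+2)], of which those with [k < 2^n] lie in
    the first quadrant. *)
Definition node (n k : nat) : R := (2 * INR k + 1) * PI / 2 ^ (n + 2).

Lemma node_half (n k : nat) : node (S n) k = node n k / 2.
Proof.
  unfold node; cbn [Nat.add pow]; field; apply pow_nonzero; lra.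
Qed.

(** The points of level [n + 1] are thus the [y/2] and the [PI/2 - y/2] for the
    points [y] of level [n]. *)
Lemma node_reflected (n k : nat) :
  (k < 2 ^ n)%nat -> node (S n) (2 ^ n + 2 ^ n - 1 - k) = PI / 2 - node n k / 2.
Proof.
  intros h; unfold node; rewrite !minus_INR, plus_INR, pow_INR by lia.
  cbn [INR]; replace (1 + 1) with 2 by ring; rewrite !pow_add; cbn [pow]; field.
  apply pow_nonzero; lra.
Qed.

Lemma node_bounds (n k : nat) : (k < 2 ^ n)%nat -> 0 < node n k < PI / 2.
Proof.
  intros h; unfold node; pose proof PI_RGT_0 as Hpi; pose proof (pos_INR k).
  assert (0 < 2 ^ n) by (apply pow_lt; lra).
  rewrite pow_add; cbn [pow]; split.
  - apply Rdiv_lt_0_compat; nra.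
  - apply (Rmult_lt_reg_r (2 ^ n * (2 * (2 * 1)))); [lra|].
    unfold Rdiv; rewrite Rmult_assoc, Rinv_l, Rmult_1_r by lra.
    assert (INR k + 1 <= 2 ^ n).
    { rewrite <- S_INR; change 2 with (INR 2); rewrite <- pow_INR; apply le_INR, h. }
    nra.
Qed.

Definition csc2 (x : R) : R := / sin x ^ 2.

(** Sum and product agree because [1/sin^2 + 1/cos^2 = 1/(sin^2 cos^2)], and
    [sin y = 2 sin (y/2) cos (y/2)]. Every symmetric function of the two values
    is hence a polynomial in [csc2 y]. *)
Lemma csc2_double (y : R) :
  0 < y < PI / 2 ->
  csc2 (y / 2) + csc2 (PI / 2 - y / 2) = 4 * csc2 y
  /\ csc2 (y / 2) * csc2 (PI / 2 - y / 2) = 4 * csc2 y.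
Proof.
  intros h; unfold csc2; rewrite sin_shift.
  replace (sin y) with (2 * sin (y / 2) * cos (y / 2))
    by (rewrite <- sin_2a; f_equal; field).
  assert (0 < sin (y / 2)) by (apply sin_gt_0; lra).
  assert (0 < cos (y / 2)) by (apply cos_gt_0; lra).
  pose proof (sin2_cos2 (y / 2)) as E; unfold Rsqr in E.
  split; [|field; lra].
  transitivity ((sin (y / 2) * sin (y / 2) + cos (y / 2) * cos (y / 2))
                / (sin (y / 2) * cos (y / 2)) ^ 2); [field; lra|].
  rewrite E; field; lra.
Qed.

Lemma mul_cos_le_sin (x : R) : 0 < x < PI / 2 -> x * cos x <= sin x.
Proof.
  intros h.
  destruct (MVT_gen (fun t => sin t - t * cos t) 0 x (fun t => t * sin t))
    as (t & Ht & E).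
  - intros t _; auto_derive; [easy|ring].
  - intros t _; apply continuity_pt_filterlim.
    apply (ex_derive_continuous (fun t => sin t - t * cos t)); auto_derive; easy.
  - rewrite Rmin_left, Rmax_right in Ht by lra.
    assert (0 <= sin t) by (apply sin_ge_0; lra).
    assert (0 <= t * sin t * (x - 0)) by (repeat apply Rmult_le_pos; lra).
    rewrite sin_0 in E.
    lra.
Qed.

(** From [sin x < x <= tan x], as [csc2 x - 1 = 1/tan^2 x]. *)
Lemma csc2_bounds (x : R) :
  0 < x < PI / 2 -> 1 <= csc2 x /\ csc2 x - 1 <= / x ^ 2 <= csc2 x.
Proof.
  intros h; unfold csc2.
  assert (Hs : 0 < sin x) by (apply sin_gt_0; lra).
  assert (Hc : 0 < cos x) by (apply cos_gt_0; lra).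
  pose proof (sin_lt_x x (proj1 h)); pose proof (mul_cos_le_sin x h).
  pose proof (sin2_cos2 x) as E; unfold Rsqr in E.
  split; [|split].
  - apply Rle_trans with (/ 1); [lra|].
    apply Rinv_le_contravar; [now apply pow_lt|].
    pose proof (Rmult_lt_0_compat _ _ Hc Hc); cbn [pow]; lra.
  - apply (Rmult_le_reg_r (x ^ 2 * sin x ^ 2));
      [apply Rmult_lt_0_compat; apply pow_lt; lra|].
    replace ((/ sin x ^ 2 - 1) * (x ^ 2 * sin x ^ 2)) with
      (x ^ 2 * (1 - sin x * sin x)) by (field; lra).
    replace (/ x ^ 2 * (x ^ 2 * sin x ^ 2)) with (sin x ^ 2) by (field; lra).
    replace (1 - sin x * sin x) with (cos x * cos x) by lra.
    replace (x ^ 2 * (cos x * cos x)) with ((x * cos x) ^ 2) by ring.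
    apply pow_incr; split; [apply Rmult_le_pos; lra|trivial].
  - apply Rinv_le_contravar; [now apply pow_lt|apply pow_incr; lra].
Qed.

(** The lower bound is a form of Bernoulli's inequality for [(s - 1)^(j+1)]. *)
Lemma power_sandwich (s y : R) (j : nat) :
  1 <= s -> s - 1 <= y <= s ->
  s ^ S j - INR (S j) * s ^ j <= y ^ S j <= s ^ S j.
Proof.
  intros hs hy; split; [|apply pow_incr; lra].
  apply Rle_trans with ((s - 1) ^ S j); [|apply pow_incr; lra].
  induction j as [|j IH]; [cbn; lra|].
  apply Rle_trans with ((s - 1) * (s ^ S j - INR (S j) * s ^ j)).
  - rewrite (S_INR (S j)); assert (0 <= INR (S j) * s ^ j).
    { apply Rmult_le_pos; [apply pos_INR|apply pow_le; lra]. }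
    cbn [pow] in *; nra.
  - change ((s - 1) ^ S (S j)) with ((s - 1) * (s - 1) ^ S j).
    apply Rmult_le_compat_l; lra.
Qed.

Definition csc_sum (j n : nat) : R := sum_below (fun k => csc2 (node n k) ^ j) (2 ^ n).

Lemma csc_sum_0 (n : nat) : csc_sum 0 n = 2 ^ n.
Proof.
  assert (h : forall N, sum_below (fun _ => 1) N = INR N).
  { induction N as [|N IH]; [reflexivity|]; now rewrite sum_below_succ, S_INR, IH. }
  unfold csc_sum; cbn [pow]; rewrite h, pow_INR; reflexivity.
Qed.

Lemma csc_sum_succ (j n : nat) :
  csc_sum j (S n) = sum_below (fun k =>
    csc2 (node n k / 2) ^ j + csc2 (PI / 2 - node n k / 2) ^ j) (2 ^ n).
Proof.
  unfold csc_sum; replace (2 ^ S n)%nat with (2 ^ n + 2 ^ n)%nat by (cbn; lia).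
  rewrite sum_below_fold; apply sum_below_ext; intros k Hk.
  now rewrite node_half, node_reflected.
Qed.

(** By [csc2_double], with [v = csc2 y], the contributions of [y] to the next level
    are [4 v], [16 v^2 - 8 v] and [64 v^3 - 48 v^2]; the closed forms solve
    the resulting linear recurrences, starting from [csc2 (PI/4) = 2]. *)
Lemma csc_sum_closed (n : nat) :
  csc_sum 1 n = 2 * 4 ^ n
  /\ csc_sum 2 n = 8 / 3 * (4 ^ n) ^ 2 + 4 / 3 * 4 ^ n
  /\ csc_sum 3 n = 64 / 15 * (4 ^ n) ^ 3 + 8 / 3 * (4 ^ n) ^ 2 + 16 / 15 * 4 ^ n.
Proof.
  induction n as [|n (E1 & E2 & E3)].
  - assert (E : csc2 (node 0 0) = 2).
    { unfold csc2, node; replace ((2 * INR 0 + 1) * PI / 2 ^ (0 + 2)) with (PI / 4)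
        by (cbn; field).
      rewrite sin_PI4; pose proof (sqrt_sqrt 2) as E2; pose proof Rlt_sqrt2_0.
      replace ((1 / sqrt 2) ^ 2) with (/ (sqrt 2 * sqrt 2)) by (field; lra).
      rewrite E2 by lra; field. }
    unfold csc_sum; cbn [Nat.pow]; rewrite !sum_below_succ, E.
    unfold sum_below; cbn; repeat split; field.
  - rewrite !csc_sum_succ.
    assert (h : forall j f, (forall s t u, s + t = 4 * u -> s * t = 4 * u ->
               s ^ j + t ^ j = f u) ->
             sum_below (fun k => csc2 (node n k / 2) ^ j
                + csc2 (PI / 2 - node n k / 2) ^ j) (2 ^ n) =
             sum_below (fun k => f (csc2 (node n k))) (2 ^ n)).
    { intros j f hf; apply sum_below_ext; intros k Hk.
      destruct (csc2_double (node n k) (node_bounds n k Hk)); now apply hf. }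
    rewrite (h 1%nat (fun u => 4 * u ^ 1 + 0 * u ^ 1)).
    rewrite (h 2%nat (fun u => 16 * u ^ 2 + -8 * u ^ 1)).
    rewrite (h 3%nat (fun u => 64 * u ^ 3 + -48 * u ^ 2)).
    + rewrite !sum_below_linear.
      fold (csc_sum 1 n); fold (csc_sum 2 n); fold (csc_sum 3 n).
      rewrite E1, E2, E3; cbn [pow]; repeat split; field.
    + intros s t u E F; replace (s ^ 3 + t ^ 3) with ((s + t) ^ 3 - 3 * (s * t) * (s + t))
        by ring; rewrite E, F; ring.
    + intros s t u E F; replace (s ^ 2 + t ^ 2) with ((s + t) ^ 2 - 2 * (s * t))
        by ring; rewrite E, F; ring.
    + intros s t u E F; lra.
Qed.

Definition odd_sum (s N : nat) : R := sum_below (fun k => / (2 * INR k + 1) ^ s) N.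

(** Since [1/(2k+1)^2 = (PI / 2^(n+2))^2 / y^2] for [y = node n k]. *)
Lemma odd_sum_node (j n : nat) :
  odd_sum (2 * j) (2 ^ n) =
  (PI ^ 2 / 16 * (/ 4) ^ n) ^ j * sum_below (fun k => (/ node n k ^ 2) ^ j) (2 ^ n).
Proof.
  transitivity (sum_below (fun k => (PI ^ 2 / 16 * (/ 4) ^ n) ^ j * (/ node n k ^ 2) ^ j
    + 0 * 0) (2 ^ n)); [|rewrite sum_below_linear; ring].
  apply sum_below_ext; intros k _.
  rewrite Rmult_0_l, Rplus_0_r, <- Rpow_mult_distr, pow_mult, <- pow_inv; f_equal.
  pose proof PI_RGT_0; pose proof (pos_INR k).
  assert (2 ^ n <> 0) by (apply pow_nonzero; lra).
  unfold node; rewrite pow_inv, pow_add; replace 4 with (2 * 2) by ring.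
  rewrite Rpow_mult_distr; cbn [pow]; field; lra.
Qed.

(** The even denominators up to [2 N] contribute [H s N / 2^s]. *)
Lemma H_double (s N : nat) : H s (N + N) = odd_sum s N + / 2 ^ s * H s N.
Proof.
  induction N as [|N IH]; [rewrite !H_0; unfold odd_sum, sum_below; cbn; ring|].
  replace (S N + S N)%nat with (S (S (N + N))) by lia.
  unfold odd_sum; rewrite sum_below_succ; fold (odd_sum s N).
  rewrite !H_succ, IH.
  replace (INR (S (S (N + N)))) with (2 * INR (S N)) by (rewrite !S_INR, plus_INR; ring).
  replace (INR (S (N + N))) with (2 * INR N + 1) by (rewrite !S_INR, plus_INR; ring).
  rewrite Rpow_mult_distr, Rinv_mult; ring.
Qed.

(** Telescoping: [1/(k+1)^2 <= 1/k - 1/(k+1)]. *)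
Lemma H_le (s n : nat) : (2 <= s)%nat -> H s n <= 2.
Proof.
  intros Hs.
  assert (h : H s (S n) <= 2 - / INR (S n)).
  { induction n as [|n IH].
    - rewrite H_succ, H_0; cbn [INR]; rewrite pow1; lra.
    - rewrite H_succ; set (x := INR (S n)) in *.
      assert (Hx : 1 <= x) by (unfold x; rewrite S_INR; pose proof (pos_INR n); lra).
      rewrite (S_INR (S n)); fold x.
      assert (/ (x + 1) ^ s <= / (x + 1) ^ 2).
      { apply Rinv_le_contravar; [apply pow_lt; lra|apply Rle_pow; [lra|trivial]]. }
      assert (/ (x + 1) ^ 2 <= / x - / (x + 1)).
      { apply (Rmult_le_reg_r (x * (x + 1) ^ 2)); [nra|].
        field_simplify; try lra; nra. }
      lra. }
  assert (Hpos : 0 < / INR (S n)) by (apply Rinv_0_lt_compat, lt_0_INR; lia).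
  assert (H s n <= H s (S n)); [|lra].
  rewrite H_succ; assert (0 < / INR (S n) ^ s); [|lra].
  apply Rinv_0_lt_compat, pow_lt, lt_0_INR; lia.
Qed.

Lemma H_converges (s : nat) : (2 <= s)%nat -> exists l : R, is_lim_seq (H s) l.
Proof.
  intros Hs; apply (ex_finite_lim_seq_incr (H s) 2); [|intros n; now apply H_le].
  intros n; rewrite H_succ; assert (0 < / INR (S n) ^ s); [|lra].
  apply Rinv_0_lt_compat, pow_lt, lt_0_INR; lia.
Qed.

Lemma filterlim_pow2 : filterlim (fun n => 2 ^ n)%nat eventually eventually.
Proof.
  intros P [N hN]; exists N; intros n Hn; apply hN.
  pose proof (Nat.pow_gt_lin_r 2 n); lia.
Qed.

(** Along the powers of 2, [H_double] gives [h = l + h / 2^s] for the limit [h]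
    of [H s]. *)
Lemma H_limit_of_odd (s : nat) (l : R) :
  (2 <= s)%nat -> is_lim_seq (fun n => odd_sum s (2 ^ n)) l ->
  is_lim_seq (H s) (l / (1 - / 2 ^ s)).
Proof.
  intros Hs Hl; destruct (H_converges s Hs) as [h Hh].
  replace (l / (1 - / 2 ^ s)) with h; [trivial|].
  assert (E1 : is_lim_seq (fun n => H s (2 ^ n)) h).
  { apply (is_lim_seq_subseq (H s)); [apply filterlim_pow2|trivial]. }
  assert (E2 : is_lim_seq (fun n => H s (2 ^ S n)) h).
  { apply (is_lim_seq_incr_1 (fun n => H s (2 ^ n))); trivial. }
  assert (E3 : is_lim_seq (fun n => H s (2 ^ S n)) (l + / 2 ^ s * h)).
  { apply is_lim_seq_ext with (fun n => odd_sum s (2 ^ n) + / 2 ^ s * H s (2 ^ n)).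
    - intros n; replace (2 ^ S n)%nat with (2 ^ n + 2 ^ n)%nat by (cbn; lia).
      now rewrite H_double.
    - apply is_lim_seq_plus'; [trivial|].
      now apply (is_lim_seq_scal_l _ _ (Finite h)). }
  apply is_lim_seq_unique in E2; apply is_lim_seq_unique in E3.
  rewrite E2 in E3; injection E3 as E3.
  assert (1 < 2 ^ s) by (apply Rlt_pow_R1; [lra|lia]).
  assert (0 < / 2 ^ s < 1).
  { split; [apply Rinv_0_lt_compat; lra|].
    apply Rlt_le_trans with (/ 1); [apply Rinv_lt_contravar|]; lra. }
  replace l with (h - / 2 ^ s * h) by lra; field.
  split; [apply pow_nonzero; lra|lra].
Qed.

(** Replacing [1/y^2] by [csc2 y] in the power sums costs at most a multiple of
    the power sum of one degree less, which is of smaller order. *)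
Lemma odd_sum_limit (j : nat) (l : R) :
  is_lim_seq (fun n => csc_sum (S j) n / (4 ^ n) ^ S j) l ->
  is_lim_seq (fun n => csc_sum j n / (4 ^ n) ^ S j) 0 ->
  is_lim_seq (fun n => odd_sum (2 * S j) (2 ^ n)) ((PI ^ 2 / 16) ^ S j * l).
Proof.
  intros Hl H0.
  set (mid n := sum_below (fun k => (/ node n k ^ 2) ^ S j) (2 ^ n) / (4 ^ n) ^ S j).
  apply is_lim_seq_ext with (fun n => (PI ^ 2 / 16) ^ S j * mid n).
  { intros n; rewrite odd_sum_node, Rpow_mult_distr; unfold mid, Rdiv.
    rewrite <- !pow_inv; ring. }
  apply (is_lim_seq_scal_l _ _ (Finite l)).
  (* the two bounds of power_sandwich, summed over the points *)
  apply is_lim_seq_le_le with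
    (fun n => csc_sum (S j) n / (4 ^ n) ^ S j - INR (S j) * (csc_sum j n / (4 ^ n) ^ S j))
    (fun n => csc_sum (S j) n / (4 ^ n) ^ S j); [|
    replace l with (l - INR (S j) * 0) by ring; apply is_lim_seq_minus'; trivial;
    now apply (is_lim_seq_scal_l _ _ (Finite 0))|trivial].
  intros n; unfold mid.
  assert (0 < / (4 ^ n) ^ S j) by (apply Rinv_0_lt_compat, pow_lt, pow_lt; lra).
  assert (h : forall k, (k < 2 ^ n)%nat ->
    csc2 (node n k) ^ S j - INR (S j) * csc2 (node n k) ^ j
      <= (/ node n k ^ 2) ^ S j <= csc2 (node n k) ^ S j).
  { intros k Hk; destruct (csc2_bounds (node n k) (node_bounds n k Hk)).
    now apply power_sandwich. }
  split.
  - replace (csc_sum (S j) n / (4 ^ n) ^ S j - INR (S j) * (csc_sum j n / (4 ^ n) ^ S j))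
      with ((1 * csc_sum (S j) n + - INR (S j) * csc_sum j n) / (4 ^ n) ^ S j)
      by (unfold Rdiv; ring).
    apply Rmult_le_compat_r; [lra|].
    unfold csc_sum; rewrite <- sum_below_linear; apply sum_below_le; intros k Hk.
    specialize (h k Hk); lra.
  - apply Rmult_le_compat_r; [lra|]; apply sum_below_le; apply h.
Qed.

Lemma lim_pow_inv4 : is_lim_seq (fun n => (/ 4) ^ n) 0.
Proof. apply is_lim_seq_geom; rewrite Rabs_pos_eq; lra. Qed.

Lemma H2_limit : is_lim_seq (H 2) (PI ^ 2 / 6).
Proof.
  replace (PI ^ 2 / 6) with ((PI ^ 2 / 16) ^ 1 * 2 / (1 - / 2 ^ 2)) by (cbn; field).
  apply H_limit_of_odd; [lia|]; apply (odd_sum_limit 0).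
  - apply is_lim_seq_ext with (fun _ => 2); [|apply is_lim_seq_const].
    intros n; rewrite (proj1 (csc_sum_closed n)); field; apply pow_nonzero; lra.
  - apply is_lim_seq_ext with (fun n => (/ 2) ^ n);
      [|apply is_lim_seq_geom; rewrite Rabs_pos_eq; lra].
    intros n; rewrite csc_sum_0, pow_1, pow_inv; replace 4 with (2 * 2) by ring.
    rewrite Rpow_mult_distr; field; apply pow_nonzero; lra.
Qed.

Lemma H4_limit : is_lim_seq (H 4) (PI ^ 4 / 90).
Proof.
  pose proof lim_pow_inv4 as L.
  replace (PI ^ 4 / 90) with ((PI ^ 2 / 16) ^ 2 * (8 / 3) / (1 - / 2 ^ 4))
    by (cbn; field).
  apply H_limit_of_odd; [lia|]; apply (odd_sum_limit 1).
  - apply is_lim_seq_ext with (fun n => 8 / 3 + 4 / 3 * (/ 4) ^ n).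
    + intros n; rewrite (proj1 (proj2 (csc_sum_closed n))), pow_inv.
      field; apply pow_nonzero; lra.
    + eapply is_lim_seq_value; [polynomial_limit|ring].
  - apply is_lim_seq_ext with (fun n => 2 * (/ 4) ^ n).
    + intros n; rewrite (proj1 (csc_sum_closed n)), pow_inv.
      field; apply pow_nonzero; lra.
    + eapply is_lim_seq_value; [polynomial_limit|ring].
Qed.

Lemma H6_limit : is_lim_seq (H 6) (PI ^ 6 / 945).
Proof.
  pose proof lim_pow_inv4 as L.
  replace (PI ^ 6 / 945) with ((PI ^ 2 / 16) ^ 3 * (64 / 15) / (1 - / 2 ^ 6))
    by (cbn; field).
  apply H_limit_of_odd; [lia|]; apply (odd_sum_limit 2).
  - apply is_lim_seq_ext with
      (fun n => 64 / 15 + 8 / 3 * (/ 4) ^ n + 16 / 15 * ((/ 4) ^ n) ^ 2).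
    + intros n; rewrite (proj2 (proj2 (csc_sum_closed n))), pow_inv.
      field; apply pow_nonzero; lra.
    + eapply is_lim_seq_value; [polynomial_limit|ring].
  - apply is_lim_seq_ext with (fun n => 8 / 3 * (/ 4) ^ n + 4 / 3 * ((/ 4) ^ n) ^ 2).
    + intros n; rewrite (proj1 (proj2 (csc_sum_closed n))), pow_inv.
      field; apply pow_nonzero; lra.
    + eapply is_lim_seq_value; [polynomial_limit|ring].
Qed.

(** * The other harmonic limits *)

Lemma H3_limit : is_lim_seq (H 3) (zeta 3).
Proof.
  destruct (H_converges 3) as [l Hl]; [lia|].
  assert (E : is_series (fun k => / Rpower (INR (S k)) 3) l).
  { change (is_lim_seq (sum_n (fun k => / Rpower (INR (S k)) 3)) l).
    apply is_lim_seq_ext with (fun n => H 3 (S n)).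
    - intros n; induction n as [|n IH].
      + rewrite H_succ, H_0, sum_O, <- Rpower_pow by (apply lt_0_INR; lia).
        replace (INR 3) with 3 by (cbn; ring); ring.
      + rewrite H_succ, IH, sum_Sn, <- Rpower_pow by (apply lt_0_INR; lia).
        replace (INR 3) with 3 by (cbn; ring); reflexivity.
    - now apply (is_lim_seq_incr_1 (H 3)). }
  apply is_series_unique in E; unfold zeta; now rewrite E.
Qed.

Lemma H1_over_n_limit : is_lim_seq (fun n => H 1 n / INR n) 0.
Proof.
  apply is_lim_seq_Reals.
  assert (E : Un_cv (fun k => / INR (S k)) 0).
  { apply is_lim_seq_Reals, (is_lim_seq_incr_1 (fun k => / INR k)).
    apply (is_lim_seq_inv INR p_infty); [apply is_lim_seq_INR|easy]. }
  apply Cesaro_1, is_lim_seq_Reals in E; apply is_lim_seq_Reals.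
  apply is_lim_seq_ext with (2 := E); intros [|n];
    [rewrite H_0; cbn; unfold Rdiv; rewrite Rinv_0; ring|].
  f_equal; cbn [pred]; induction n as [|n IH].
  - rewrite H_succ, H_0, pow_1; cbn; ring.
  - cbn [sum_f_R0]; now rewrite IH, (H_succ 1 (S n)), pow_1.
Qed.

(** * Numerical bounds *)

(** From [PI/4 = 2 atan (1/3) + atan (1/7)]; the terms of the alternating series
    decrease by a factor of at least 9, and those up to the indices 16 and 17 suffice. *)
Lemma PI_bounds : 3.141592653589793 < PI < 3.141592653589794.
Proof.
  pose proof (PI_2_3_7_ineq 8) as h.
  unfold tg_alt, PI_2_3_7_tg, Ratan_seq in h.
  cbn [sum_f_R0 Nat.mul Nat.add] in h; rewrite !INR_IZR_INZ in h.
  cbn [Z.of_nat Pos.of_succ_nat Pos.succ pow] in h.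
  split; lra.
Qed.

(** Truncations of the midpoint Euler-Maclaurin expansion of the sum of [1/j^3]
    over [j > n], in terms of [u = 2 n + 1]. Its terms alternate, and successive
    truncations bound the tail from above and from below. *)
Definition tail_upper (u : R) : R := 2 / u ^ 2 - 2 / u ^ 4 + 14 / 3 / u ^ 6.
Definition tail_lower (u : R) : R := tail_upper u - 62 / 3 / u ^ 8.

(** For [v = 2 j], the middle of [v - 1] and [v + 1], the claim compares [1/j^3]
    with a telescoping difference. In the variable [v^2 - 1] all coefficients of
    the numerator of the error are positive. *)
Lemma tail_upper_step (v : R) :
  1 < v -> 8 / v ^ 3 <= tail_upper (v - 1) - tail_upper (v + 1).
Proof.
  intros h; assert (0 < v ^ 2 - 1) by nra.
  assert (E : tail_upper (v - 1) - tail_upper (v + 1) - 8 / v ^ 3 =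
    (992 / 3 * (v ^ 2 - 1) ^ 3 + 920 * (v ^ 2 - 1) ^ 2 + 896 * (v ^ 2 - 1) + 896 / 3)
    / (v ^ 3 * (v ^ 2 - 1) ^ 6)).
  { unfold tail_upper; field; repeat split; lra. }
  enough (0 < tail_upper (v - 1) - tail_upper (v + 1) - 8 / v ^ 3) by lra.
  rewrite E; set (s := v ^ 2 - 1) in *.
  pose proof (pow_lt s 3); pose proof (pow_lt s 2).
  apply Rdiv_lt_0_compat; [nra|apply Rmult_lt_0_compat; apply pow_lt; lra].
Qed.

Lemma tail_lower_step (v : R) :
  1 < v -> tail_lower (v - 1) - tail_lower (v + 1) <= 8 / v ^ 3.
Proof.
  intros h; assert (0 < v ^ 2 - 1) by nra.
  assert (E : 8 / v ^ 3 - (tail_lower (v - 1) - tail_lower (v + 1)) =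
    (3048 * (v ^ 2 - 1) ^ 4 + 13984 * (v ^ 2 - 1) ^ 3 + 72512 / 3 * (v ^ 2 - 1) ^ 2
     + 55552 / 3 * (v ^ 2 - 1) + 15872 / 3)
    / (v ^ 3 * (v ^ 2 - 1) ^ 8)).
  { unfold tail_lower, tail_upper; field; repeat split; lra. }
  enough (0 < 8 / v ^ 3 - (tail_lower (v - 1) - tail_lower (v + 1))) by lra.
  rewrite E; set (s := v ^ 2 - 1) in *.
  pose proof (pow_lt s 4); pose proof (pow_lt s 3); pose proof (pow_lt s 2).
  apply Rdiv_lt_0_compat; [nra|apply Rmult_lt_0_compat; apply pow_lt; lra].
Qed.

Lemma tail_limits :
  is_lim_seq (fun n => tail_upper (2 * INR n + 1)) 0
  /\ is_lim_seq (fun n => tail_lower (2 * INR n + 1)) 0.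
Proof.
  assert (L : is_lim_seq (fun n => / (2 * INR n + 1)) 0).
  { apply (is_lim_seq_inv _ p_infty); [|discriminate].
    apply is_lim_seq_le_p_loc with INR; [|apply is_lim_seq_INR].
    exists 0%nat; intros n _; pose proof (pos_INR n); lra. }
  assert (pos : forall n, 2 * INR n + 1 <> 0) by (intros n; pose proof (pos_INR n); lra).
  split.
  - apply is_lim_seq_ext with (fun n =>
      2 * (/ (2 * INR n + 1)) ^ 2 - 2 * (/ (2 * INR n + 1)) ^ 4
      + 14 / 3 * (/ (2 * INR n + 1)) ^ 6).
    + intros n; unfold tail_upper; field; apply pos.
    + eapply is_lim_seq_value; [polynomial_limit|ring].
  - apply is_lim_seq_ext with (fun n =>
      2 * (/ (2 * INR n + 1)) ^ 2 - 2 * (/ (2 * INR n + 1)) ^ 4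
      + 14 / 3 * (/ (2 * INR n + 1)) ^ 6 - 62 / 3 * (/ (2 * INR n + 1)) ^ 8).
    + intros n; unfold tail_lower, tail_upper; field; apply pos.
    + eapply is_lim_seq_value; [polynomial_limit|ring].
Qed.

(** [H 3 n] with the upper (lower) correction is decreasing (increasing) in [n]
    and has the limit [zeta 3]. *)
Lemma zeta3_bounds (n : nat) :
  H 3 n + tail_lower (2 * INR n + 1) <= zeta 3 <= H 3 n + tail_upper (2 * INR n + 1).
Proof.
  destruct tail_limits as [LU LL].
  assert (E : forall k, / INR (S k) ^ 3 = 8 / (2 * INR (S k)) ^ 3
     /\ 2 * INR k + 1 = 2 * INR (S k) - 1 /\ 1 < 2 * INR (S k)).
  { intros k; pose proof (pos_INR k); rewrite S_INR; repeat split; [field|ring|]; lra. }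
  split.
  - apply (is_lim_seq_incr_compare (fun n => H 3 n + tail_lower (2 * INR n + 1))).
    + replace (zeta 3) with (zeta 3 + 0) by ring.
      apply is_lim_seq_plus'; [apply H3_limit|exact LL].
    + intros k; destruct (E k) as (E1 & E2 & E3).
      rewrite H_succ, E1, E2.
      pose proof (tail_lower_step _ E3); lra.
  - apply (is_lim_seq_decr_compare (fun n => H 3 n + tail_upper (2 * INR n + 1))).
    + replace (zeta 3) with (zeta 3 + 0) by ring.
      apply is_lim_seq_plus'; [apply H3_limit|exact LU].
    + intros k; destruct (E k) as (E1 & E2 & E3).
      rewrite H_succ, E1, E2.
      pose proof (tail_upper_step _ E3); lra.
Qed.

Lemma zeta3_numeric : 1.20205690315 < zeta 3 < 1.20205690318.
Proof.
  pose proof (zeta3_bounds 16) as h; unfold tail_lower, tail_upper in h.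
  replace (2 * INR 16 + 1) with 33 in h by (cbn; ring).
  rewrite !H_succ, H_0, !INR_IZR_INZ in h.
  cbn [Z.of_nat Pos.of_succ_nat Pos.succ] in h.
  lra.
Qed.

(** The numerator of the limit, with [a] for [PI^2] and [z] for [zeta 3]. *)
Definition limit_numerator (a z : R) : R :=
  74250517 / 2700 - 22600 / 9 * a + 140 * a ^ 2 - 88 / 7 * a ^ 3
  - 6080 * z + 2560 * z ^ 2 + 1 / 90 * (960 * a - 10080) * a ^ 2.

Lemma limit_numeric (a z : R) :
  3.141592653589793 ^ 2 < a < 3.141592653589794 ^ 2 ->
  1.20205690315 < z < 1.20205690318 ->
  44.427077 <= limit_numerator a z / (7 - 2 / 3 * a) ^ 3 < 44.427078.
Proof.
  intros ha hz; unfold limit_numerator.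
  assert (h2 : (3.141592653589793 ^ 2) ^ 2 <= a ^ 2 <= (3.141592653589794 ^ 2) ^ 2)
    by (split; apply pow_incr; lra).
  assert (h3 : (3.141592653589793 ^ 2) ^ 3 <= a ^ 3 <= (3.141592653589794 ^ 2) ^ 3)
    by (split; apply pow_incr; lra).
  (* Tangent and secant bounds for [z^2]: the terms [-6080 z] and [2560 z^2]
     nearly cancel in their dependence on [z], so bounding them separately by
     intervals would be too coarse. *)
  pose proof (Rle_0_sqr (z - 1.20205690315)) as hz1; unfold Rsqr in hz1.
  pose proof (Rmult_lt_0_compat (z - 1.20205690315) (1.20205690318 - z)) as hz2.
  specialize (hz2 ltac:(lra) ltac:(lra)).
  assert (hd : 0 < (7 - 2 / 3 * a) ^ 3) by (apply pow_lt; lra).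
  split.
  - apply (proj1 (Rle_div_r _ _ _ hd)); lra.
  - apply (proj2 (Rlt_div_l _ _ _ hd)); lra.
Qed.

(** * The central moments and their ratio *)

(** The formulas for [m 2 n] and [m 6 n], made homogeneous by the variable [y],
    which is to be 1. *)
Definition second_form (x y h1 h2 : R) : R :=
  7 * x ^ 2 + 13 * x * y - 2 * (x + y) * h1 - 4 * (x + y) ^ 2 * h2.

Definition sixth_form (x y h1 h2 h3 h4 h5 h6 : R) : R :=
  1 / 2700 * x * (74250517 * x ^ 5 + 523547007 * x ^ 4 * y
                  + 1579578725 * x ^ 3 * y ^ 2 + 2571768745 * x ^ 2 * y ^ 3
                  + 2342670258 * x * y ^ 4 + 1133389148 * y ^ 5)
  - 2 / 3 * (x + y) * (11300 * x ^ 4 + 56270 * x ^ 3 * y + 135760 * x ^ 2 * y ^ 2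
                       + 145510 * x * y ^ 3 + 68427 * y ^ 4) * h1
  + 20 * (63 * x ^ 2 + 117 * x * y + 329 * y ^ 2) * (x + y) ^ 2 * h1 ^ 2
  - 120 * (x + y) ^ 3 * h1 ^ 3
  + (- (4 / 3) * (11300 * x ^ 4 + 51710 * x ^ 3 * y + 101830 * x ^ 2 * y ^ 2
                  + 93640 * x * y ^ 3 + 26013 * y ^ 4) * (x + y) ^ 2
     + 240 * (21 * x ^ 2 + 39 * x * y + 68 * y ^ 2) * (x + y) ^ 3 * h1
     - 720 * (x + y) ^ 4 * h1 ^ 2) * h2
  + (240 * (21 * x ^ 2 + 39 * x * y + 37 * y ^ 2) * (x + y) ^ 4
     - 1440 * (x + y) ^ 5 * h1) * h2 ^ 2
  - 960 * (x + y) ^ 6 * h2 ^ 3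
  + (- (160) * (38 * x ^ 3 + 225 * x ^ 2 * y + 325 * x * y ^ 2 + 159 * y ^ 3)
       * (x + y) ^ 3
     + 7360 * y * (x + y) ^ 4 * h1 + 9600 * y * (x + y) ^ 5 * h2) * h3
  + 2560 * (x + y) ^ 6 * h3 ^ 2
  + (- (480) * (21 * x ^ 2 + 39 * x * y + 37 * y ^ 2) * (x + y) ^ 4
     + 2880 * (x + y) ^ 5 * h1 + 5760 * (x + y) ^ 6 * h2) * h4
  - 11520 * y * (x + y) ^ 5 * h5
  - 7680 * (x + y) ^ 6 * h6.

Lemma second_form_homogeneous (t x y h1 h2 : R) :
  second_form (t * x) (t * y) (t * h1) h2 = t ^ 2 * second_form x y h1 h2.
Proof. unfold second_form; ring. Qed.

Lemma sixth_form_homogeneous (t x y h1 h2 h3 h4 h5 h6 : R) :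
  sixth_form (t * x) (t * y) (t * h1) h2 h3 h4 h5 h6 =
  t ^ 6 * sixth_form x y h1 h2 h3 h4 h5 h6.
Proof. unfold sixth_form; ring. Qed.

Lemma second_moment (n : nat) :
  m 2 n = second_form (INR n) 1 (H 1 n) (H 2 n).
Proof.
  destruct (esym_harmonic n) as (T0 & T1 & T2 & _).
  rewrite central_moment; cbn [sum_f_R0 Nat.sub]; rewrite !moment_tabulated by lia.
  cbn [nth moment_table tabulated horner fold_right].
  rewrite T0, T1, T2; unfold Binomial.C, second_form.
  cbn [fact Nat.sub Nat.mul Nat.add INR]; field.
Qed.

Lemma sixth_moment (n : nat) :
  m 6 n = sixth_form (INR n) 1 (H 1 n) (H 2 n) (H 3 n) (H 4 n) (H 5 n) (H 6 n).
Proof.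
  destruct (esym_harmonic n) as (T0 & T1 & T2 & T3 & T4 & T5 & T6).
  rewrite central_moment; cbn [sum_f_R0 Nat.sub]; rewrite !moment_tabulated by lia.
  cbn [nth moment_table tabulated horner fold_right].
  rewrite T0, T1, T2, T3, T4, T5, T6; unfold sixth_form.
  assert (EC : Binomial.C 6 0 = 1 /\ Binomial.C 6 1 = 6 /\ Binomial.C 6 2 = 15
    /\ Binomial.C 6 3 = 20 /\ Binomial.C 6 4 = 15 /\ Binomial.C 6 5 = 6
    /\ Binomial.C 6 6 = 1).
  { unfold Binomial.C; cbn [Nat.sub]; rewrite !INR_IZR_INZ; cbn -[Rdiv].
    repeat split; field. }
  destruct EC as (-> & -> & -> & -> & -> & -> & ->).
  generalize (INR n), (H 1 n), (H 2 n), (H 3 n), (H 4 n), (H 5 n), (H 6 n).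
  intros x h1 h2 h3 h4 h5 h6; field.
Qed.

(** Dividing [n], [1] and [H_1(n)] by [n] multiplies numerator and denominator of
    the ratio by the same power [n^(-6)], and turns both into continuous functions
    of convergent sequences. *)
Lemma scaled_sixth_moment_limit :
  7 - 2 / 3 * PI ^ 2 <> 0 ->
  is_lim_seq (fun n => m 6 n / m 2 n ^ 3)
    (limit_numerator (PI ^ 2) (zeta 3) / (7 - 2 / 3 * PI ^ 2) ^ 3).
Proof.
  intros Hd; destruct (H_converges 5) as [l5 H5_limit]; [lia|].
  pose proof H1_over_n_limit as L1; pose proof H2_limit as L2.
  pose proof H3_limit as L3; pose proof H4_limit as L4; pose proof H6_limit as L6.
  assert (Hinv : is_lim_seq (fun n => / INR n) 0).
  { apply (is_lim_seq_inv INR p_infty); [apply is_lim_seq_INR|discriminate]. }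
  apply is_lim_seq_ext_loc with (fun n =>
    sixth_form 1 (/ INR n) (H 1 n / INR n) (H 2 n) (H 3 n) (H 4 n) (H 5 n) (H 6 n)
    / second_form 1 (/ INR n) (H 1 n / INR n) (H 2 n) ^ 3).
  { exists 1%nat; intros n Hn.
    assert (Hx : INR n <> 0) by (apply not_0_INR; lia).
    rewrite sixth_moment, second_moment.
    set (f := sixth_form 1 _ _ _ _ _ _ _); set (g := second_form 1 _ _ _).
    replace (sixth_form (INR n) 1 (H 1 n) _ _ _ _ _) with (INR n ^ 6 * f).
    - replace (second_form (INR n) 1 (H 1 n) (H 2 n)) with (INR n ^ 2 * g).
      + unfold Rdiv; rewrite Rpow_mult_distr, <- pow_mult, Rinv_mult.
        cbn [Nat.mul Nat.add].
        generalize (/ g ^ 3); intros w; field; trivial.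
      + unfold g; rewrite <- second_form_homogeneous; f_equal; field; trivial.
    - unfold f; rewrite <- sixth_form_homogeneous; f_equal; field; trivial. }
  apply (is_lim_seq_div' _ (fun n => second_form 1 (/ INR n) (H 1 n / INR n) (H 2 n) ^ 3)).
  - unfold sixth_form; eapply is_lim_seq_value; [polynomial_limit|].
    unfold limit_numerator; field.
  - unfold second_form; eapply is_lim_seq_value; [polynomial_limit|field].
  - now apply pow_nonzero.
Qed.

Theorem theorem6 :
  (forall n : nat, (1 <= n)%nat ->
    let x := INR n in
    let H1 := H 1 n in
    let H2 := H 2 n in
    let H3 := H 3 n in
    let H4 := H 4 n in
    let H5 := H 5 n in
    let H6 := H 6 n in
    m 6 n =
      1 / 2700 * x * (74250517 * x ^ 5 + 523547007 * x ^ 4 + 1579578725 * x ^ 3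
                      + 2571768745 * x ^ 2 + 2342670258 * x + 1133389148)
      - 2 / 3 * (x + 1) * (11300 * x ^ 4 + 56270 * x ^ 3 + 135760 * x ^ 2
                           + 145510 * x + 68427) * H1
      + 20 * (63 * x ^ 2 + 117 * x + 329) * (x + 1) ^ 2 * H1 ^ 2
      - 120 * (x + 1) ^ 3 * H1 ^ 3
      + (- (4 / 3) * (11300 * x ^ 4 + 51710 * x ^ 3 + 101830 * x ^ 2
                      + 93640 * x + 26013) * (x + 1) ^ 2
         + 240 * (21 * x ^ 2 + 39 * x + 68) * (x + 1) ^ 3 * H1
         - 720 * (x + 1) ^ 4 * H1 ^ 2) * H2
      + (240 * (21 * x ^ 2 + 39 * x + 37) * (x + 1) ^ 4
         - 1440 * (x + 1) ^ 5 * H1) * H2 ^ 2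
      - 960 * (x + 1) ^ 6 * H2 ^ 3
      + (- 160 * (38 * x ^ 3 + 225 * x ^ 2 + 325 * x + 159) * (x + 1) ^ 3
         + 7360 * (x + 1) ^ 4 * H1
         + 9600 * (x + 1) ^ 5 * H2) * H3
      + 2560 * (x + 1) ^ 6 * H3 ^ 2
      + (- 480 * (21 * x ^ 2 + 39 * x + 37) * (x + 1) ^ 4
         + 2880 * (x + 1) ^ 5 * H1
         + 5760 * (x + 1) ^ 6 * H2) * H4
      - 11520 * (x + 1) ^ 5 * H5
      - 7680 * (x + 1) ^ 6 * H6)
  /\
  (let L :=
     (74250517 / 2700 - 22600 / 9 * PI ^ 2 + 140 * PI ^ 4 - 88 / 7 * PI ^ 6
      - 6080 * zeta 3 + 2560 * zeta 3 ^ 2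
      + 1 / 90 * (960 * PI ^ 2 - 10080) * PI ^ 4)
     / (7 - 2 / 3 * PI ^ 2) ^ 3 in
   is_lim_seq (fun n => m 6 n / m 2 n ^ 3) (Finite L)
   /\ 44.427077 <= L < 44.427078).
Proof.
  split.
  - intros n _; cbv zeta; rewrite sixth_moment; unfold sixth_form; ring.
  - pose proof PI_bounds as hpi.
    assert (ha : 3.141592653589793 ^ 2 < PI ^ 2 < 3.141592653589794 ^ 2) by nra.
    assert (hL : (74250517 / 2700 - 22600 / 9 * PI ^ 2 + 140 * PI ^ 4 - 88 / 7 * PI ^ 6
      - 6080 * zeta 3 + 2560 * zeta 3 ^ 2
      + 1 / 90 * (960 * PI ^ 2 - 10080) * PI ^ 4)
     / (7 - 2 / 3 * PI ^ 2) ^ 3 =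
       limit_numerator (PI ^ 2) (zeta 3) / (7 - 2 / 3 * PI ^ 2) ^ 3).
    { unfold limit_numerator; f_equal; ring. }
    cbv zeta; rewrite hL; split.
    + apply scaled_sixth_moment_limit; lra.
    + apply limit_numeric; [exact ha|exact zeta3_numeric].
Qed.
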